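(* Let $A$ be an algebra generated by a linear subspace $V\subseteq A$ and let $L:A\to\mathbb{R}$ be a linear functional with $L(1)=1$ and $L(a^2)\ge0$ for all $a\in A$. Put $s_L(a):=\sqrt{L(a^2)}$ with associated form $\langle a,b\rangle_{s_L}=L(ab)$, and suppose there exists a complete $s_L$-orthonormal system $\{e_n:n\in\mathbb{N}\}$ in $V$. Choose $(\lambda_n)_{n\in\mathbb{N}}\subseteq\mathbb{R}_{>0}$ with $\sum_{n=1}^\infty\lambda_n^2<\infty$ and set $$U:=\Big\{v\in V:\ \sum_{n=1}^\infty\lambda_n^{-2}\langle v,e_n\rangle_{s_L}^2<\infty\Big\},\qquad q(v):=\sqrt{\sum_{n=1}^\infty\lambda_n^{-2}\langle v,e_n\rangle_{s_L}^2}\quad(v\in U),$$ and $J(U):=\{\langle W\rangle: W\text{ finite dimensional subspace of }U\}$. If $\{\alpha\in X(A):\alpha\restriction_U\text{ is }s_L\text{-continuous}\}\neq\emptyset$ and for each $S\in J(U)$ there exists a representing Radon measure $\nu_S$ for $L\restriction_S$ on $X(S)$, then there exists a representing Radon measure $\nu$ for $L\restriction_{\langle U\rangle}$ on $X(\langle U\rangle)$ such that $\nu(X(\langle U\rangle)\setminus M)=0$, where $M:=\{\alpha\in X(\langle U\rangle):\alpha\restriction_U\text{ is }q\text{-continuous}\}$.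
   Context: Algebras are unital commutative $\mathbb{R}$-algebras (not necessarily finitely generated). For an algebra $A$, the character space $X(A)$ is the set of all $\mathbb{R}$-algebra homomorphisms $A\to\mathbb{R}$; it is assumed non-empty and carries the weakest topology making all maps $\hat a:X(A)\to\mathbb{R}$, $\hat a(\alpha)=\alpha(a)$ ($a\in A$), continuous, and its Borel $\sigma$-algebra. $A$ is generated by a linear subspace $V$ if $V$ contains a set of generators of $A$; $\langle W\rangle$ is the subalgebra of $A$ generated by $W$. A Radon measure is a non-negative Borel measure that is locally finite and inner regular with respect to compact sets. A representing Radon measure for a linear functional $L$ on an algebra $A$ is a Radon measure $\nu$ on $X(A)$ with $L(a)=\int_{X(A)}\hat a\,d\nu$ for all $a\in A$. For a Hilbertian seminorm $p$ (a seminorm induced by a symmetric positive semidefinite bilinear form $\langle\cdot,\cdot\rangle_p$) on $V$, a subset $E\subseteq V$ is $p$-orthonormal if $\langle e,e'\rangle_p=0$ for distinct $e,e'\in E$ and $p(e)=1$ for $e\in E$; it is a complete $p$-orthonormal system in $V$ if moreover $\mathrm{span}(E)$ is dense in $(V,p)$. A linear functional $l$ on $U$ is $q$-continuous if $|l(v)|\le Cq(v)$ for all $v\in U$, for some $C>0$ (similarly for $s_L$). *)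

(* Defs.v *)
From HB Require Import structures.
From mathcomp Require Import all_boot all_order all_algebra.
From mathcomp Require Import all_classical all_reals all_analysis.

Set Implicit Arguments.
Unset Strict Implicit.
Unset Printing Implicit Defensive.

Import Order.TTheory GRing.Theory Num.Theory.
Import numFieldNormedType.Exports.

Local Open Scope classical_set_scope.
Local Open Scope ring_scope.

Section LinearSubspaces.
Variables (R : realType) (A : lmodType R).
Implicit Types (V W E : set A) (form : A -> A -> R).

Definition is_subspace V : Prop := submod_closed [in V].

Definition linear_span E : set A := smallest is_subspace E.

Definition is_fin_dim_subspace W : Prop :=
  is_subspace W /\ exists s : seq A, W = linear_span [set` s].

(* The seminorm induced by a symmetric positive semidefinite form. *)
Definition hilbert_seminorm form (v : A) : R := Num.sqrt (form v v).

Definition orthonormal form E : Prop :=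
  (forall e e' : A, E e -> E e' -> e <> e' -> form e e' = 0) /\
  (forall e : A, E e -> hilbert_seminorm form e = 1).

Definition complete_orthonormal_system form V E : Prop :=
  [/\ E `<=` V, orthonormal form E &
      forall v : A, V v -> forall eps : R, 0 < eps ->
        exists2 w : A, linear_span E w & hilbert_seminorm form (v - w) < eps].

End LinearSubspaces.

Section GeneratedSubalgebra.
Variables (R : realType) (A : comAlgType R).
Implicit Types V W : set A.

Definition is_subalgebra (S : set A) : Prop := subalg_closed [in S].

Definition generated_pred W : A -> bool :=
  fun a => a \in smallest is_subalgebra W.

Lemma generated_pred_subalg W : subalg_closed (generated_pred W).
Proof.
split=> [|k a b|a b]; rewrite /generated_pred !inE.
- by move=> S [[S1 _ _] _]; move: S1; rewrite !inE.
- move=> Wa Wb S SW; have [[_ Sl _] _] := SW.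
  by have := Sl k a b; rewrite !inE; apply; [exact: Wa|exact: Wb].
- move=> Wa Wb S SW; have [[_ _ Sm] _] := SW.
  by have := Sm a b; rewrite !inE; apply; [exact: Wa|exact: Wb].
Qed.

HB.instance Definition _ W :=
  GRing.isSubalgClosed.Build R A (generated_pred W)
    (GRing.subalg_closed_semi (generated_pred_subalg W)).

Definition generated W : subalgClosed A :=
  GRing.SubalgClosed.clone R A (generated_pred W) _.

Definition generates V : Prop :=
  exists2 G : set A, G `<=` V & forall a : A, a \in generated G.

(* J(U) *)
Definition fin_dim_generated U : set (subalgClosed A) :=
  [set generated W | W in [set W | is_fin_dim_subspace W /\ W `<=` U]].

End GeneratedSubalgebra.

Section SubalgebraType.
Variables (R : realType) (A : comAlgType R) (S : subalgClosed A).

Definition subalg := {a : A | a \in S}.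

HB.instance Definition _ := [isSub of subalg for @sval _ _].
HB.instance Definition _ := [Choice of subalg by <:].
HB.instance Definition _ := [SubChoice_isSubAlgebra of subalg by <:].
HB.instance Definition _ := [SubNzRing_isSubComNzRing of subalg by <:].

Definition subalg_incl : subalg -> A := \val.

HB.instance Definition _ := GRing.RMorphism.on subalg_incl.
HB.instance Definition _ := GRing.Linear.on subalg_incl.

End SubalgebraType.

Definition character (R : realType) (B : comAlgType R) :=
  {lrmorphism B -> R | *%R}.

Definition ev (R : realType) (B : comAlgType R) (b : B) (alpha : character B) :
  R := alpha b.

Section CharacterSpace.
Variables (R : realType) (B : comAlgType R).

HB.instance Definition _ := gen_eqMixin (character B).
HB.instance Definition _ := gen_choiceMixin (character B).
(* The supremum over b of the initial topologies of ev b is the weakest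
   topology making every ev b continuous. *)
HB.instance Definition _ := Topological.copy (character B)
  (sup_topology (fun b : B =>
     Topological.class (initial_topology (ev b : character B -> R)))).

(* Measurable types are pointed, so the measurable space X(B) is formed from
   a proof that X(B) is non-empty; neither the topology nor the Borel sets
   depend on the chosen point. *)
Definition character_space (X0 : [set: character B] !=set0) : Type :=
  character B.

Variable X0 : [set: character B] !=set0.

HB.instance Definition _ := Topological.on (character_space X0).
HB.instance Definition _ :=
  isPointed.Build (character_space X0) (projT1 (cid X0)).

End CharacterSpace.

Section Restriction.
Variables (R : realType) (A : comAlgType R) (S : subalgClosed A).

Definition restrict_character (alpha : {lrmorphism A -> R | *%R}) :
    character (subalg S) :=
  GRing.LRMorphism.clone R (subalg S) R *%R (alpha \o @subalg_incl R A S) _.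

Lemma restrict_nonempty :
  [set: character A] !=set0 -> [set: character (subalg S)] !=set0.
Proof. by move=> [alpha _]; exists (restrict_character alpha). Qed.

End Restriction.

Notation borel T := (g_sigma_algebraType (@open T)).

(* Used on Hausdorff spaces only, where compact sets are Borel. *)
Definition is_radon (R : realType) (T : ptopologicalType)
    (nu : {measure set (borel T) -> \bar R}) : Prop :=
  (forall x : T, exists2 O : set T, open_nbhs x O & (nu O < +oo)%E) /\
  (forall E : set (borel T), measurable E ->
     nu E = ereal_sup [set nu K | K in [set K : set T | compact K /\ K `<=` E]]).

Definition is_representing_radon (R : realType) (B : comAlgType R)
    (X0 : [set: character B] !=set0) (l : B -> R)
    (nu : {measure set (borel (character_space X0)) -> \bar R}) : Prop :=
  is_radon nu /\
  forall b : B,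
    nu.-integrable setT (fun alpha => (ev b alpha)%:E) /\
    (l b)%:E = (\int[nu]_alpha (ev b alpha)%:E)%E.

Definition seminorm_continuous (R : realType) (T : Type) (D : set T)
    (p l : T -> R) : Prop :=
  exists2 C : R, 0 < C & forall v : T, D v -> `|l v| <= C * p v.

Section Functional.
Variables (R : realType) (A : comAlgType R) (L : A -> R).

Definition s_norm (a : A) : R := Num.sqrt (L (a ^+ 2)).

Definition s_form (a b : A) : R := L (a * b).

Variables (V : set A) (e : nat -> A) (lambda : nat -> R).

Definition weighted_sum (v : A) : \bar R :=
  (\sum_(0 <= n <oo) (lambda n ^- 2 * s_form v (e n) ^+ 2)%:E)%E.

Definition weighted_space : set A :=
  [set v | V v /\ (weighted_sum v < +oo)%E].

(* Meaningful on weighted_space only, where the sum is finite. *)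
Definition weighted_norm (v : A) : R := Num.sqrt (fine (weighted_sum v)).

End Functional.

(* Main.v *)
Require Import Defs.
From HB Require Import structures.
From mathcomp Require Import all_boot all_order all_algebra.
From mathcomp Require Import all_classical all_reals all_analysis.
From mathcomp Require Import measurable_realfun lra.

Set Implicit Arguments.
Unset Strict Implicit.
Unset Printing Implicit Defensive.

Import Order.TTheory GRing.Theory Num.Theory.
Import numFieldNormedType.Exports.

Local Open Scope classical_set_scope.
Local Open Scope ring_scope.

(** The measure on the characters of the algebra generated by [U] is the law of a
    random character [T t], where [t] is a point of [0, 1) chosen with Lebesgue
    measure.

    The representing measures that are given on the subalgebras generated by finite
    dimensional subspaces of [U] are not assumed to be compatible. An ultrafilter on
    these subspaces turns them into one finitely additive probability [pr] on the
    disjoint union of their character spaces, whose events are the sets with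
    measurable sections. Countably many events are singled out: that the energy, the
    sum of [lambda n ^+ 2] times the squared value at [e n], is at most an integer
    [r], and that the value at [e m] exceeds a given rational number. Deciding these
    events one after the other cuts [0, 1) into intervals whose lengths are the
    probabilities of the cells so obtained. A point [t] selects a decreasing sequence
    of cells of positive probability, hence a proper filter: the sets that contain
    one of these cells up to a null set of [pr].

    Suppose that the energy is bounded by [r] on one of the cells of [t]. Along the
    filter of [t] the value at [e m] converges, since it is bounded and its position
    relative to each rational number is decided. For [u] in [U] the difference
    between the value at [u] and its Fourier expansion has a second moment that tends
    to 0 by completeness of the orthonormal system, so it exceeds a positive bound
    only on a null set; and by the Cauchy-Schwarz inequality the expansion is
    controlled by the square root of [r] times the weighted norm of [u]. So the value
    at [u] converges (lemma [cvg_value_U]) to a limit bounded by that quantity (lemma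
    [lim_value_le]). As sums, products and relations are respected at all late
    stages, the limits form a character (lemma [branch_character]), continuous for the
    weighted norm. The mean of the energy is at most the sum of the squares of
    [lambda], so by Markov almost every [t] is of this kind (lemma
    [lebesgue_good_points]).

    Nearby points select the same cells, so [T] is continuous outside the countably
    many ends of intervals (lemma [branch_limit_near]). The law of [T] is therefore a
    Radon measure: inner regularity of Lebesgue measure is transported by continuous
    maps (lemma [image_measure_radon]). As to the moments, the lemma of Fatou bounds
    the integral of the square of [T t b] by [L (b ^+ 2)] (lemma [fatou_branch]); this
    inequality for all [b + c] with [c] real forces the integral of [T t b] to be
    [L b] (lemma [image_measure_representing]). *)

(** * Coding a finitely additive probability by the unit interval *)

Section Coding.
Context {R : realType} {Om : Type}.

(** Finite additivity is stated by splitting along an event, the only form in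
    which it is used: cells are split one question at a time. *)
Definition is_content (Ev : set (set Om)) (m : set Om -> R) : Prop :=
  (forall E, Ev E -> 0 <= m E) /\
  (forall E G, Ev E -> Ev G -> m E = m (E `&` G) + m (E `\` G)).

Variables (Ev : set (set Om)) (pr : set Om -> R) (G : nat -> set Om).
Hypothesis EvT : Ev setT.
Hypothesis EvI : forall E F, Ev E -> Ev F -> Ev (E `&` F).
Hypothesis EvD : forall E F, Ev E -> Ev F -> Ev (E `\` F).
Hypothesis pr_content : is_content Ev pr.
Hypothesis pr1 : pr setT = 1.
Hypothesis EvG : forall k, Ev (G k).

(** A node stands for the cell [event] of outcomes that gave prescribed answers
    to the questions [G 0], ..., [G (depth - 1)]; it occupies the half-open
    interval of length [pr event] starting at [left]. *)
Record node := Node { depth : nat; event : set Om; left : R }.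

Definition split_point (s : node) : R := left s + pr (event s `\` G (depth s)).

Definition right (s : node) : R := left s + pr (event s).

(** The interval of a node is cut in two: the part to the left of the cut is for
    the outcomes outside [G depth], the part to the right for those inside. *)
Definition no_child (s : node) : node :=
  Node (depth s).+1 (event s `\` G (depth s)) (left s).

Definition yes_child (s : node) : node :=
  Node (depth s).+1 (event s `&` G (depth s)) (split_point s).

Definition step (t : R) (s : node) : node :=
  if t < split_point s then no_child s else yes_child s.

Definition root := Node 0%N setT 0.

Definition branch (t : R) (n : nat) : node := iter n (step t) root.

Lemma rightE (s : node) : Ev (event s) ->
  right s = split_point s + pr (event s `&` G (depth s)).
Proof.
move=> Es; rewrite /right /split_point (pr_content.2 (event s) (G (depth s)))//.
lra.
Qed.

Lemma Ev_step t s : Ev (event s) -> Ev (event (step t s)).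
Proof. by move=> Es; rewrite /step; case: ifP => _ /=; [exact: EvD|exact: EvI]. Qed.

Lemma event_branch t n : Ev (event (branch t n)).
Proof. by elim: n => [|n ih]; [exact: EvT|exact: Ev_step]. Qed.

Lemma depth_branch t n : depth (branch t n) = n.
Proof. by elim: n => //= n; rewrite /step; case: ifP => _ /= ->. Qed.

Lemma step_bounds t s : Ev (event s) -> left s <= t < right s ->
  left (step t s) <= t < right (step t s).
Proof.
move=> Es /andP[lt tr]; rewrite /step; case: ltP => h; first by rewrite /right/= lt.
by rewrite /right/= h -rightE.
Qed.

Lemma branch_bounds t n : 0 <= t < 1 -> left (branch t n) <= t < right (branch t n).
Proof.
move=> t01; elim: n => [|n ih]; first by rewrite /right/= pr1 add0r.
by apply: step_bounds => //; exact: event_branch.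
Qed.

(** The interval of a cell that is visited contains [t], and half-open intervals
    that contain a point have positive length. There is thus no exceptional set
    of branches here: cells of probability zero are never visited. *)
Lemma pr_branch_gt0 t n : 0 <= t < 1 -> 0 < pr (event (branch t n)).
Proof.
move=> /(@branch_bounds t n)/andP[lt tr]; rewrite -(ltrD2l (left (branch t n))) addr0.
exact: le_lt_trans tr.
Qed.

Lemma branch_decided t n :
  event (branch t n.+1) `<=` G n \/ event (branch t n.+1) `<=` ~` G n.
Proof.
rewrite /branch /= -/(branch t n) /step; case: ifP => _; rewrite /= depth_branch.
  by right; exact: subDsetr.
by left; exact: subIsetr.
Qed.

Lemma subset_branch t n k : event (branch t (k + n)) `<=` event (branch t n).
Proof.
elim: k => // k; apply: subset_trans; rewrite addSn /= /step.
by case: ifP => _ /=; [exact: subDsetl|exact: subIsetl].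
Qed.

Lemma left_step t s : Ev (event s) -> left s <= left (step t s).
Proof.
move=> Es; rewrite /step; case: ifP => //= _.
by rewrite lerDl; apply: pr_content.1; exact: EvD.
Qed.

Lemma right_step t s : Ev (event s) -> right (step t s) <= right s.
Proof.
move=> Es; rewrite /step; case: ifP => //= _; rewrite [right s]rightE// /right//=.
by rewrite lerDl; apply: pr_content.1; exact: EvI.
Qed.

(** The first [n] answers are constant on the interval of the [n]-th node. This
    is what makes the random character a continuous function of [t]. *)
Lemma branch_locally_constant t t' n :
  left (branch t n) <= t' < right (branch t n) -> branch t' n = branch t n.
Proof.
elim: n => //= n ih /andP[lt' t'r].
have Et := event_branch t n.
have pE : branch t' n = branch t n.
  apply: ih; rewrite (le_trans (left_step t Et))//=.
  exact: lt_le_trans (right_step t Et).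
rewrite /= in pE; rewrite pE; set s := branch t n in Et lt' t'r *.
rewrite /branch -/s in lt' t'r *.
move: lt' t'r; rewrite {1 2 4}/step.
case: (ltP t (split_point s)) => h; first by rewrite /right/= => _; rewrite /step => ->.
by rewrite /right/= => h' _; rewrite /step ltNge h'.
Qed.

Lemma iter_step t n s : iter n.+1 (step t) s =
  if t < split_point s then iter n (step t) (no_child s) else iter n (step t) (yes_child s).
Proof. by rewrite iterSr [in step t s]/step; case: ifP. Qed.

Lemma measurable_iter_step (f : node -> R) n s :
  measurable_fun [set: R] (fun t => f (iter n (step t) s)).
Proof.
elim: n s => [|n ih] s; first exact: (measurable_cst (f s)).
under eq_fun do rewrite iter_step fun_if.
apply: measurable_fun_ifT => //; apply: measurable_fun_ltr => //; exact: measurable_cst.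
Qed.

Lemma measurable_branch (f : node -> R) n :
  measurable_fun [set: R] (fun t => f (branch t n)).
Proof. exact: measurable_iter_step. Qed.

Lemma finite_iter_step_left n s : finite_set [set t | left (iter n (step t) s) = t].
Proof.
elim: n s => [|n ih] s.
  by apply: (sub_finite_set _ (finite_set1 (left s))) => t /= ->.
apply: (@sub_finite_set _ _ ([set t | left (iter n (step t) (no_child s)) = t] `|`
    [set t | left (iter n (step t) (yes_child s)) = t])).
  by move=> t /=; rewrite -iterS iter_step; case: ifP => _ ?; [left|right].
by rewrite finite_setU; split; exact: ih.
Qed.

Local Notation mu := (@lebesgue_measure R).

(** When [m] has density [f] with respect to [pr], this is the conditional mean
    of [f] given the cell: along the branches it is a martingale. *)
Definition ratio (m : set Om -> R) (s : node) : R := m (event s) / pr (event s).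

Lemma ratio_ge0 m s : is_content Ev m -> Ev (event s) -> 0 <= ratio m s.
Proof. by move=> mc Es; rewrite divr_ge0 ?mc.1 ?pr_content.1. Qed.

(** The mean of the conditional means is at most the total mass. It can be less,
    as a cell that is null for [pr] may have positive mass. *)
Lemma integral_iter_step m n s : is_content Ev m -> Ev (event s) ->
  (\int[mu]_(t in `[left s, right s[) (ratio m (iter n (step t) s))%:E
   <= (m (event s))%:E)%E.
Proof.
move=> mc; elim: n s => [|n ih] s Es.
  rewrite /= integral_cst//= lebesgue_measure_itv/= lte_fin.
  rewrite /ratio /right -ltrBlDl subrr; case: ifPn => pE.
    by rewrite -EFinD -EFinM lee_fin [_ + pr _]addrC addrK divfK ?gt_eqF.
  (* a cell of probability zero occupies an empty interval *)
  by rewrite mule0 lee_fin mc.1.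
have lc : left s <= split_point s by rewrite lerDl pr_content.1//; exact: EvD.
have cr : split_point s <= right s by rewrite rightE// lerDl pr_content.1//; exact: EvI.
have En : Ev (event (no_child s)) by exact: EvD.
have Ey : Ev (event (yes_child s)) by exact: EvI.
have ry : right (yes_child s) = right s by rewrite [RHS]rightE.
have Evit t k s' : Ev (event s') -> Ev (event (iter k (step t) s')).
  by move=> ?; elim: k => //= k; exact: Ev_step.
rewrite (itv_bndbnd_setU (x := BLeft (split_point s))) ?bnd_simp//.
rewrite ge0_integral_setU//; last 3 first.
- apply: measurable_funTS; apply/measurable_EFinP; exact: measurable_iter_step.
- by move=> t _; rewrite lee_fin ratio_ge0//; exact: Evit.
- apply/disj_setPS => t [/=]; rewrite !in_itv/= => /andP[_ tc] /andP[ct _].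
  by move: tc; rewrite ltNge ct.
rewrite (mc.2 _ (G (depth s)))// [X in (_ <= X%:E)%E]addrC EFinD; apply: leeD.
  apply: le_trans (ih _ En); rewrite le_eqVlt; apply/orP; left; apply/eqP.
  apply: eq_integral => t; rewrite inE/= in_itv/= => /andP[_ tc].
  by rewrite -iterS iter_step tc.
apply: le_trans (ih _ Ey); rewrite ry le_eqVlt; apply/orP; left; apply/eqP.
apply: eq_integral => t; rewrite inE/= in_itv/= => /andP[ct _].
by rewrite -iterS iter_step ltNge ct.
Qed.

Lemma integral_branch m n : is_content Ev m ->
  (\int[mu]_(t in `[0%R, 1%R[) (ratio m (branch t n))%:E <= (m setT)%:E)%E.
Proof.
move=> mc; have := integral_iter_step n mc (EvT : Ev (event root)).
by rewrite {1}/right/= pr1 add0r.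
Qed.

Lemma measurable_ratio m n (D : set R) :
  measurable_fun D (fun t : R => (ratio m (branch t n))%:E).
Proof. apply: measurable_funTS; apply/measurable_EFinP; exact: measurable_branch. Qed.

(** The properties that hold almost surely once finitely many of the answers along
    the branch of [t] are known. As only the null sets of a finitely additive
    probability are discarded, a statement that holds with a probability tending
    to one in the approximations holds along every branch, and no exceptional
    set of [t] arises from it, however many such statements there are. *)
Definition branch_filter (t : R) : set_system Om :=
  [set Q | exists n N, [/\ Ev N, pr N = 0 & event (branch t n) `\` Q `<=` N]].

Lemma Ev_set0 : Ev set0.
Proof. by rewrite -(setDv setT); exact: EvD. Qed.

Lemma pr_set0 : pr set0 = 0.
Proof.
have := pr_content.2 _ _ EvT EvT; rewrite setIT setDv => /eqP.
by rewrite -subr_eq0 opprD addrA subrr add0r oppr_eq0 => /eqP.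
Qed.

Lemma pr_le E F : Ev E -> Ev F -> E `<=` F -> pr E <= pr F.
Proof.
move=> EE EF EsubF; rewrite (pr_content.2 F E)// [F `&` E]setIidr//.
by rewrite lerDl pr_content.1//; exact: EvD.
Qed.

Lemma pr0_subset E F : Ev E -> Ev F -> E `<=` F -> pr F = 0 -> pr E = 0.
Proof.
move=> EE EF EsubF F0; apply/eqP; rewrite eq_le pr_content.1// andbT -F0.
exact: pr_le.
Qed.

Lemma Ev_setU E F : Ev E -> Ev F -> Ev (E `|` F).
Proof.
move=> EE EF; rewrite (_ : E `|` F = setT `\` ((setT `\` E) `&` (setT `\` F))).
  by apply: EvD => //; apply: EvI; exact: EvD.
by rewrite !setTD setCI !setCK.
Qed.

Lemma pr0_setU E F : Ev E -> Ev F -> pr E = 0 -> pr F = 0 -> pr (E `|` F) = 0.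
Proof.
move=> EE EF E0 F0; have EU := Ev_setU EE EF.
rewrite (pr_content.2 _ E)// [_ `&` E]setIidr ?E0 ?add0r; last exact: subsetUl.
apply: (@pr0_subset _ F) => //; first exact: EvD.
by move=> x [[]].
Qed.

#[global] Instance branch_filter_filter t : Filter (branch_filter t).
Proof.
split.
- by exists 0%N, set0; split; [exact: Ev_set0|exact: pr_set0|move=> x []].
- move=> P Q [n [N [EN N0 PN]]] [k [M [EM M0 QM]]].
  exists (k + n)%N, (N `|` M); split; [exact: Ev_setU|exact: pr0_setU|].
  move=> x [px /not_andP[nP|nQ]]; [left; apply: PN|right; apply: QM]; split=> //.
    exact: subset_branch px.
  by move: px; rewrite addnC; exact: subset_branch.
- move=> P Q PQ [n [N [EN N0 PN]]]; exists n, N; split => // x [px nQ].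
  by apply: PN; split => // /PQ.
Qed.

Lemma branch_filter_proper t : 0 <= t < 1 -> ProperFilter (branch_filter t).
Proof.
move=> t01; apply: Build_ProperFilter.
move=> [n [N [EN N0 PN]]]; have := pr_branch_gt0 n t01.
rewrite (@pr0_subset _ N)// ?ltxx//; first exact: event_branch.
by move: PN; rewrite setD0.
Qed.

Lemma branch_filter_event t n : branch_filter t (event (branch t n)).
Proof.
by exists n, set0; split; [exact: Ev_set0|exact: pr_set0|move=> x []].
Qed.

Lemma branch_filter_null t N : Ev N -> pr N = 0 -> branch_filter t (~` N).
Proof. by move=> EN N0; exists 0%N, N; split => // x [_ /contrapT]. Qed.

Lemma branch_filter_decided t k :
  branch_filter t (G k) \/ branch_filter t (~` G k).
Proof.
by have [h|h] := branch_decided t k; [left|right];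
  apply: filterS h (branch_filter_event t k.+1).
Qed.

(** The points that are never the left end of their interval, so that a whole
    neighbourhood shares any given finite number of their answers. *)
Definition interior_points : set R :=
  [set t | 0 <= t < 1 /\ forall n, left (branch t n) < t].

(** If [Y] is within [eps / 2] of [c], up to a null set, on a cell that [t] visits,
    then so it is on the branch of each [t'] that visits this cell. *)
Lemma branch_limit_near (Y : Om -> R) (t c eps : R) :
  interior_points t -> 0 < eps -> Y @ branch_filter t --> c ->
  \forall t' \near t, forall c', 0 <= t' < 1 -> Y @ branch_filter t' --> c' ->
    `|c - c'| < eps.
Proof.
move=> [t01 tl] eps0 Yc.
have e20 : 0 < eps / 2 by rewrite divr_gt0.
have /cvgrPdist_lt/(_ _ e20)[n [N [EN N0 YN]]] := Yc.
have /andP[_ tr] := branch_bounds n t01.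
have : \forall t' \near t, t' \in `]left (branch t n), right (branch t n)[.
  by apply: near_in_itvoo; rewrite in_itv/= tl.
apply: filterS => t'; rewrite in_itv/= => /andP[lt' t'r] c' t'01 Yc'.
have pE : branch t' n = branch t n by apply: branch_locally_constant; rewrite ltW.
have Ft' : branch_filter t' (fun w => `|c - Y w| < eps / 2).
  by exists n, N; split => //; rewrite pE.
have PF := branch_filter_proper t'01.
have /cvgrPdist_lt/(_ _ e20) Yc'e := Yc'.
have [w [h1 h2]] := filter_ex (filterI Ft' Yc'e).
rewrite (_ : c - c' = (c - Y w) - (c' - Y w)); last lra.
by rewrite (le_lt_trans (ler_normB _ _))//= (splitr eps) ltrD.
Qed.

Lemma measurable_branch_set (P : node -> Prop) n :
  measurable [set t : R | P (branch t n)].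
Proof.
have mP := @measurable_branch (fun s => (`[< P s >])%:R) n.
have := mP measurableT [set 1] (measurable_set1 _).
rewrite setTI (_ : _ @^-1` _ = [set t : R | P (branch t n)])//.
apply/seteqP; split=> t /=; last by move=> /asboolT ->.
by case: asboolP => // _ /eqP; rewrite eq_sym oner_eq0.
Qed.

Lemma measurable_interior_points : measurable interior_points.
Proof.
rewrite (_ : interior_points =
    `[0, 1[%classic `&` \bigcap_n [set t : R | left (branch t n) < t]).
  apply: measurableI => //; apply: bigcapT_measurable => n.
  rewrite -[X in measurable X]setTI.
  apply: (@measurable_fun_ltr _ _ _ setT (fun t => left (branch t n)) id) => //.
  exact: measurable_branch.
apply/seteqP; split=> t /=; rewrite in_itv/=.
  by move=> [? h]; split => // n _; exact: h.
by move=> [? h]; split => // n; exact: (h n Logic.I).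
Qed.

Lemma lebesgue_interior_points : mu (`[0, 1[ `\` interior_points) = 0%E.
Proof.
apply/countable_lebesgue_measure0.
apply: (@sub_countable _ _ _ (\bigcup_n [set t | left (branch t n) = t])).
  apply: subset_card_le => t /= [t01]; move: t01; rewrite in_itv/= => t01 h.
  apply: contrapT => nb; apply: h; split => // n.
  rewrite lt_neqAle; have /andP[-> _] := branch_bounds n t01; rewrite andbT.
  by apply/eqP => e; apply: nb; exists n.
apply: bigcup_countable => // n _; apply: finite_set_countable.
exact: finite_iter_step_left.
Qed.

(** The coding carries [pr] to Lebesgue measure, for the events that are asked
    about. This is the bound of [integral_branch] for the content that is
    supported off [G k], whose ratio is 0 or 1 after question [k]. *)
Lemma lebesgue_avoid k :
  (mu [set t : R | (0 <= t < 1)%R /\ event (branch t k.+1) `<=` ~` G k]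
   <= (pr (setT `\` G k))%:E)%E.
Proof.
pose m E := pr (E `\` G k).
have mc : is_content Ev m.
  split=> [E EE|E F EE EF]; first by apply: pr_content.1; exact: EvD.
  rewrite /m (pr_content.2 _ F)//; last exact: EvD.
  congr (pr _ + pr _); apply/seteqP; split => x; rewrite /setI /setD /=; tauto.
set B := [set t : R | _].
have mB : measurable B.
  rewrite (_ : B = `[0, 1[%classic `&`
      [set t | event (branch t k.+1) `<=` ~` G k]); last first.
    by apply/seteqP; split => t /=; rewrite in_itv.
  apply: measurableI => //.
  exact: (measurable_branch_set (fun s => event s `<=` ~` G k)).
apply: le_trans (integral_branch k.+1 mc).
have -> : mu B = (\int[mu]_(t in B) (1%R)%:E)%E by rewrite integral_cst// mul1e.
have r0 t : 0 <= ratio m (branch t k.+1) by rewrite ratio_ge0//; exact: event_branch.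
apply: (@le_trans _ _ (\int[mu]_(t in B) (ratio m (branch t k.+1))%:E)%E).
  apply: ge0_le_integral => //; first exact: measurable_ratio.
  move=> t [t01 ht]; rewrite lee_fin /ratio /m.
  rewrite (_ : _ `\` G k = event (branch t k.+1)) ?divff ?gt_eqF ?pr_branch_gt0//.
  by apply/seteqP; split => [x []//|x px]; split => //; exact: ht.
apply: ge0_subset_integral => //; [exact: measurable_ratio| |].
  by move=> t _; rewrite lee_fin r0.
by move=> t [t01 _]; rewrite /= in_itv.
Qed.

(** If [m] is at least [c * pr] on the events where [c <= Y] up to a null set, and
    [Y] tends to [x t] along the branch of [t], then the ratio of [m] is eventually
    at least [x t - e]; the bound on the integral of the ratio passes to the limit
    by the lemma of Fatou. *)
Lemma fatou_branch (Y : Om -> R) (m : set Om -> R) (x : R -> R) (D : set R) :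
  is_content Ev m ->
  (forall c E N, Ev E -> Ev N -> pr N = 0 -> (forall w, E w -> ~ N w -> c <= Y w) ->
    c * pr E <= m E) ->
  measurable D -> D `<=` `[0, 1[ -> measurable_fun D x -> (forall t, 0 <= x t) ->
  (forall t, D t -> Y @ branch_filter t --> x t) ->
  (\int[mu]_(t in D) (x t)%:E <= (m setT)%:E)%E.
Proof.
move=> mc mY mD D01 mx x0 Yx.
pose h n t := (ratio m (branch t n))%:E.
have mh n E : measurable_fun E (h n) by exact: measurable_ratio.
have h0 n t : (0 <= h n t)%E by rewrite lee_fin ratio_ge0//; exact: event_branch.
apply: (@le_trans _ _ (\int[mu]_(t in D) (limn_einf (h^~ t)))%E).
  apply: ge0_le_integral => //.
  - by move=> t _; rewrite lee_fin.
  - exact/measurable_EFinP.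
  - rewrite /limn_einf; apply: measurableT_comp => //.
    apply: (@measurable_fun_limn_esup _ _ _ D (fun n t => (- h n t)%E)) => n.
    exact: measurableT_comp.
  move=> t Dt.
  have t01 : 0 <= t < 1 by have := D01 _ Dt; rewrite /= in_itv.
  apply/lee_subgt0Pr => e e0.
  rewrite limn_einf_lim; apply: lime_ge; first exact: is_cvg_einfs.
  have /cvgrPdist_lt/(_ _ e0)[k [N [EN N0 YN]]] := Yx t Dt.
  (* all cells from the k-th on lie, up to the null set N, where Y > x t - e *)
  exists k => // n /= kn.
  apply: le_ereal_inf_tmp => _ [j /= nj <-].
  rewrite /h -EFinB lee_fin /ratio ler_pdivlMr ?pr_branch_gt0//.
  apply: (mY _ _ N) => //; first exact: event_branch.
  move=> w pw nN; apply: contrapT => /negP; rewrite -ltNge => hlt.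
  apply: nN; apply: YN; split.
    by move: pw; rewrite -(subnK (leq_trans kn nj)); exact: subset_branch.
  by move=> /=; rewrite ltr_norml => /andP[_]; rewrite ltNge => /negP; apply; lra.
apply: le_trans (fatou mu mD (fun n => mh n D) (fun n t _ => h0 n t)) _.
rewrite limn_einf_lim; apply: lime_le; first exact: is_cvg_einfs.
exists 0%N => // n _; apply: le_trans (ereal_inf_lbound _) _.
  by exists n => //=.
apply: le_trans (integral_branch n mc); apply: ge0_subset_integral => //; exact: mh.
Qed.

End Coding.

(** * Convergence along a filter *)

(** The limit is the supremum of the numbers that [Y] eventually exceeds. An
    ultrafilter decides everything, but the filter of a branch decides only the
    countably many comparisons that were asked; rational ones suffice. *)
Lemma decided_cvg {R : realType} {T : Type} (F : set_system T) (Y : T -> R) (C : R) :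
  ProperFilter F -> F [set w | `|Y w| <= C] ->
  (forall x : rat, F [set w | ratr x < Y w] \/ F (~` [set w | ratr x < Y w])) ->
  cvg (Y @ F).
Proof.
move=> PF bY dY; pose S := [set x : R | F [set w | x < Y w]].
have S_ub : ubound S C.
  move=> x Sx; have [w [xw]] := filter_ex (filterI Sx bY).
  by rewrite /= ler_norml => /andP[_ wC]; rewrite (le_trans (ltW xw)).
have S_sup : has_sup S.
  split; last by exists C.
  exists (- C - 1); apply: filterS bY => w /=; rewrite ler_norml => /andP[Cw _].
  by rewrite (lt_le_trans _ Cw)// ltrBlDr ltrDl.
apply/cvg_ex; exists (sup S); apply/cvgrPdist_lt => e e0.
have [x Sx xe] := sup_adherent e0 S_sup.
have [r] := @rat_in_itvoo R (sup S) (sup S + e) ltac:(by rewrite ltrDl).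
rewrite in_itv/= => /andP[rl ru].
have rS : F (~` [set w | ratr r < Y w]).
  case: (dY r) => // Sr; have := ub_le_sup S_sup.2 Sr.
  by rewrite leNgt rl.
apply: filterS2 Sx rS => w /= xw /negP; rewrite -leNgt => wr.
rewrite ltr_distl; lra.
Qed.

Lemma uniform_limit_cvg {R : realType} {T : Type} (F : set_system T) (f : T -> R) :
  ProperFilter F ->
  (forall eps, 0 < eps -> exists g : T -> R,
     cvg (g @ F) /\ F [set w | `|f w - g w| <= eps]) -> cvg (f @ F).
Proof.
move=> FF h; apply/cauchy_cvgP/cauchy_exP => eps eps0.
have e2 : 0 < eps / 2 by rewrite divr_gt0.
have [g [gc fg]] := h _ e2.
exists (lim (g @ F)); have /cvgrPdist_lt/(_ _ e2) := gc.
apply: filterS2 fg => w /= fg gl.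
rewrite -ball_normE /= (_ : _ - f w = (lim (g @ F) - g w) - (f w - g w)); last lra.
by rewrite (le_lt_trans (ler_normB _ _))// [ltRHS]splitr ltr_leD.
Qed.

Lemma is_cvg_linear_combination {R : realType} {T J : Type} (F : set_system T)
    (r : seq J) (c : J -> R) (f : J -> T -> R) :
  Filter F -> (forall j, cvg (f j @ F)) -> cvg ((fun w => \sum_(j <- r) c j * f j w) @ F).
Proof.
move=> FF fc; elim: r => [|j r ih].
  by under eq_fun do rewrite big_nil; exact: is_cvg_cst.
under eq_fun do rewrite big_cons.
by apply: is_cvgD => //; apply: is_cvgM => //; exact: is_cvg_cst.
Qed.

(** * Ultralimits of measures *)

Section Ultralimit.
Context {R : realType} {I : Type} (F : set_system I) {FU : UltraFilter F}.
Context (d : I -> measure_display) (T : forall i, measurableType (d i)).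
Variable (P : forall i, {measure set (T i) -> \bar R}).

(** The events of the disjoint union that are measurable on each summand: the
    internal sets of the construction of Loeb. *)
Definition internal : set (set {i & T i}) :=
  [set E | forall i, measurable (existT T i @^-1` E)].

Lemma internalT : internal setT.
Proof. by move=> i; rewrite preimage_setT. Qed.

Lemma internalI E G : internal E -> internal G -> internal (E `&` G).
Proof. by move=> iE iG i; rewrite preimage_setI; exact: measurableI. Qed.

Lemma internalD E G : internal E -> internal G -> internal (E `\` G).
Proof.
by move=> iE iG i; rewrite setDE preimage_setI preimage_setC -setDE; exact: measurableD.
Qed.

Definition section_mass (f : {i & T i} -> R) (E : set {i & T i}) (i : I) : R :=
  fine (\int[P i]_(x in existT T i @^-1` E) (f (existT T i x))%:E)%E.

(** For [f = 1] this is the ultralimit of the probabilities of the sections of an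
    internal event; it is only finitely additive. *)
Definition mass (f : {i & T i} -> R) (E : set {i & T i}) : R :=
  lim (section_mass f E @ F).

Section OneDensity.
Variables (f : {i & T i} -> R) (C : R).
Hypothesis f0 : forall w, 0 <= f w.
Hypothesis mf : forall i, measurable_fun setT (fun x : T i => f (existT T i x)).
Hypothesis fC : \forall i \near F, (\int[P i]_x (f (existT T i x))%:E <= C%:E)%E.

Let mfE i (D : set (T i)) : measurable_fun D (fun x : T i => (f (existT T i x))%:E).
Proof. by apply: measurable_funTS; apply/measurable_EFinP. Qed.

Lemma section_massE E : internal E -> \forall i \near F,
  (section_mass f E i)%:E =
    (\int[P i]_(x in existT T i @^-1` E) (f (existT T i x))%:E)%E /\
  section_mass f E i <= C.
Proof.
move=> iE; apply: filterS fC => i iC.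
have uC : (\int[P i]_(x in existT T i @^-1` E) (f (existT T i x))%:E <= C%:E)%E.
  apply: le_trans iC; apply: ge0_subset_integral => //.
  by move=> x _; rewrite lee_fin.
have u0 : (0 <= \int[P i]_(x in existT T i @^-1` E) (f (existT T i x))%:E)%E.
  by apply: integral_ge0 => x _; rewrite lee_fin.
have ufin : (\int[P i]_(x in existT T i @^-1` E) (f (existT T i x))%:E)%E \is a fin_num.
  by rewrite ge0_fin_numE// (le_lt_trans uC)// ltry.
by rewrite -lee_fin /section_mass fineK.
Qed.

Lemma section_mass_ge0 E i : 0 <= section_mass f E i.
Proof. by apply: fine_ge0; apply: integral_ge0 => x _; rewrite lee_fin. Qed.

Lemma mass_cvg E : internal E -> section_mass f E @ F --> mass f E.
Proof.
move=> iE; apply: (@decided_cvg _ _ F _ C); last by move=> x; exact: in_ultra_setVsetC.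
apply: filterS (section_massE iE) => i [_ iC] /=.
by rewrite ger0_norm ?section_mass_ge0.
Qed.

Lemma mass_content : is_content internal (mass f).
Proof.
split=> [E iE|E G iE iG].
  apply: cvgr_to_ge (mass_cvg iE) _; apply: nearW => i; exact: section_mass_ge0.
have iEG := internalI iE iG; have iEDG := internalD iE iG.
rewrite [LHS]/mass; apply: cvg_lim => //.
apply: cvg_trans; last exact: cvgD (mass_cvg iEG) (mass_cvg iEDG).
apply: near_eq_cvg.
apply: filterS3 (section_massE iE) (section_massE iEG) (section_massE iEDG).
move=> i [eE _] [eEG _] [eEDG _].
apply: EFin_inj; rewrite [LHS]EFinD eE eEG eEDG.
rewrite -ge0_integral_setU//; first by rewrite -preimage_setU setUIDK.
- by move=> x _; rewrite lee_fin.
- by apply/disj_setPS => x [[_ ?] []].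
Qed.

Lemma mass_le : mass f setT <= C.
Proof.
apply: cvgr_to_le (mass_cvg internalT) _.
by apply: filterS (section_massE internalT) => i [].
Qed.

End OneDensity.

Hypothesis P1 : forall i, P i setT = 1%E.

Local Notation pr := (mass (fun=> 1)).

Let one_ge0 (w : {i & T i}) : 0 <= 1 :> R. Proof. exact: ler01. Qed.
Let one_measurable i : measurable_fun setT (fun x : T i => 1 : R).
Proof. exact: measurable_cst. Qed.
Let one_mass : \forall i \near F, (\int[P i]_x 1%:E <= 1%:E)%E.
Proof. by apply: nearW => i; rewrite integral_cst// P1 mule1. Qed.

Lemma limit_pr_content : is_content internal pr.
Proof. exact: mass_content one_mass. Qed.

Lemma limit_prT : pr setT = 1.
Proof.
rewrite /mass; apply: cvg_lim => //.
rewrite (_ : section_mass _ _ = fun=> 1); first exact: cvg_cst.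
by apply/funext => i; rewrite /section_mass preimage_setT integral_cst// P1 mule1.
Qed.

(** Stages outside a set of the ultrafilter do not count. *)
Lemma limit_pr_near (Z : set I) : F Z ->
  internal [set w | ~ Z (projT1 w)] /\ pr [set w : {i & T i} | ~ Z (projT1 w)] = 0.
Proof.
move=> FZ; have iZ : internal [set w | ~ Z (projT1 w)].
  move=> i; rewrite (_ : _ @^-1` _ = [set _ | ~ Z i])//.
  have [Zi|Zi] := pselect (Z i).
    by rewrite (_ : [set _ | _] = set0)// -subset0.
  by rewrite (_ : [set _ | _] = setT)// -subTset.
split => //; rewrite /mass; apply: cvg_lim => //.
apply: cvg_near_cst; apply: filterS FZ => i Zi.
rewrite /section_mass (_ : _ @^-1` _ = set0) ?integral_set0//.
by rewrite -subset0 => x /=.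
Qed.

(** Null sets can be ignored in a lower bound for the density, as [mass f] is
    monotone and the null set carries no [pr]. *)
Lemma mass_ge (f : {i & T i} -> R) (C c : R) E N :
  (forall w, 0 <= f w) ->
  (forall i, measurable_fun setT (fun x : T i => f (existT T i x))) ->
  (\forall i \near F, (\int[P i]_x (f (existT T i x))%:E <= C%:E)%E) ->
  internal E -> internal N -> pr N = 0 ->
  (forall w, E w -> ~ N w -> c <= f w) -> c * pr E <= mass f E.
Proof.
move=> f0 mf fC iE iN N0 cf.
have [c0|c0] := leP c 0.
  apply: (@le_trans _ _ 0); first by rewrite mulr_le0_ge0// limit_pr_content.1.
  exact: (mass_content f0 mf fC).1.
have iD := internalD iE iN; have iEN := internalI iE iN.
have EN0 : pr (E `&` N) = 0.
  apply/eqP; rewrite eq_le limit_pr_content.1// andbT -N0 setIC.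
  by rewrite [X in _ <= X](limit_pr_content.2 _ E)// lerDl limit_pr_content.1//; exact: internalD.
rewrite (limit_pr_content.2 E N)// EN0 add0r ((mass_content f0 mf fC).2 E N)//.
rewrite -[leLHS]add0r lerD ?(mass_content f0 mf fC).1//.
have prD := mass_cvg one_ge0 one_measurable one_mass iD.
rewrite -subr_ge0.
apply: cvgr_to_ge (cvgB (mass_cvg f0 mf fC iD) (cvgM (cvg_cst c) prD)) _.
apply: filterS2 (section_massE f0 mf fC iD)
  (section_massE one_ge0 one_measurable one_mass iD).
move=> i [fi _] [oi _].
rewrite subr_ge0 -lee_fin fi EFinM oi -ge0_integralZl//.
apply: ge0_le_integral => //.
  + by move=> x _; rewrite -EFinM lee_fin mulr1 ltW.
  + by apply: measurable_funTS; apply/measurable_EFinP.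
  + by move=> x [Ex Nx]; rewrite -EFinM lee_fin mulr1 cf.
by rewrite lee_fin ltW.
Qed.

(** The inequality of Markov, uniform in the stages, passes to the ultralimit. *)
Lemma pr_markov (f : {i & T i} -> R) (C c : R) E :
  (forall w, 0 <= f w) ->
  (forall i, measurable_fun setT (fun x : T i => f (existT T i x))) ->
  (\forall i \near F, (\int[P i]_x (f (existT T i x))%:E <= C%:E)%E) ->
  internal E -> (forall w, E w -> c <= f w) -> c * pr E <= C.
Proof.
move=> f0 mf fC iE cf; have fc := mass_content f0 mf fC.
have i0 : internal set0 by move=> i; rewrite preimage_set0.
have pr0 : pr set0 = 0.
  have := limit_pr_content.2 _ _ i0 i0; rewrite setIid setDv; lra.
apply: le_trans (mass_ge f0 mf fC iE i0 pr0 _) _; first by move=> w Ew _; exact: cf.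
apply: le_trans (mass_le f0 mf fC).
rewrite (fc.2 _ _ internalT iE) setTI lerDl; apply: fc.1; apply: internalD => //.
exact: internalT.
Qed.

End Ultralimit.

(** * Radon laws of random characters *)

Section RadonImage.
Context {R : realType} {B : comAlgType R} (X0 : [set: character B] !=set0).
Local Notation X := (character_space X0).
Local Notation mu := (@lebesgue_measure R).

Lemma character_eq (x y : character B) : (forall b, x b = y b) -> x = y.
Proof.
case: x => x cx; case: y => y cy /= xy.
have e : x = y by exact/funext.
subst y; congr GRing.LRMorphism.Pack.
case: cx cy => [[a1] [a2] [a3]] [[b1] [b2] [b3]].
by rewrite (Prop_irrelevance a1 b1) (Prop_irrelevance a2 b2) (Prop_irrelevance a3 b3).
Qed.

(** The topology is the weakest one that makes all evaluations continuous. *)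
Lemma cvg_character (F : set_system X) (x : X) : Filter F ->
  (forall b, (fun y : X => ev b y) @ F --> ev b x) -> F --> x.
Proof.
move=> FF h; apply/cvg_sup => b A.
change (@nbhs _ (initial_topology (ev b : character B -> R)) x A -> F A).
rewrite nbhsE => -[V [[W oW WV] Vx] VA].
apply: filterS VA _; rewrite -WV; apply: (h b W).
by apply: open_nbhs_nbhs; split => //; rewrite -WV in Vx.
Qed.

Lemma ev_continuous (b : B) : continuous (fun y : X => ev b y).
Proof.
move=> x; rewrite -/(_ @ _ --> _); have := @cvg_id _ (nbhs x).
move/(cvg_sup _ _ (nbhs_filter x)) => /(_ b) h A Ax; apply: (h (ev b @^-1` A)).
have [W [oW Wx WA]] : exists W : set R, [/\ open W, W (ev b x) & W `<=` A].
  by move: Ax; rewrite nbhsE => -[W [oW Wx] WA]; exists W.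
change (@nbhs _ (initial_topology (ev b : character B -> R)) x (ev b @^-1` A)).
rewrite nbhsE; exists (ev b @^-1` W) => [|y Wy]; last exact: WA.
by split => //; exists W.
Qed.

Lemma hausdorff_character_space : hausdorff_space X.
Proof.
move=> x y xy; apply: character_eq => b; apply: (@Rhausdorff R).
move=> U V Ux Vy.
have [z [zU zV]] := xy _ _ (@ev_continuous b x _ Ux) (@ev_continuous b y _ Vy).
by exists (ev b z).
Qed.

(** [T] is a random character, continuous on the set [D] of full measure. *)
Variables (T : R -> X) (D : set R) (x0 : X).
Hypothesis mD : measurable D.
Hypothesis T_outside : forall t, ~ D t -> T t = x0.
Hypothesis T_near : forall t b e, D t -> 0 < e ->
  \forall t' \near t, D t' -> `|ev b (T t) - ev b (T t')| < e.

Lemma T_cvg t : D t -> T @ within D (nbhs t) --> T t.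
Proof.
move=> Dt; apply: cvg_character => b; apply/cvgrPdist_lt => e e0.
exact: T_near.
Qed.

Lemma T_continuous (K : set R) : K `<=` D -> {within K, continuous T}.
Proof.
move=> KD; apply/subspace_continuousP => t Kt.
apply: cvg_trans; last exact: T_cvg (KD _ Kt).
apply: cvg_app => A; rewrite /within /= !nbhs_simpl/=.
by apply: filterS => s DA /KD; exact: DA.
Qed.

(** The space of characters need not have a countable base. Measurability holds
    because the preimage of an open set is relatively open in [D]. *)
Lemma measurable_T :
  measurable_fun [set: measurableTypeR R] (T : measurableTypeR R -> borel X).
Proof.
apply: (@measurability _ _ _ _ _ (T : measurableTypeR R -> borel X) (@open X)) => //.
move=> _ [U oU <-]; rewrite setTI.
pose V := [set t | D t -> U (T t)]°.
rewrite (_ : T @^-1` U = (D `&` V) `|` (~` D `&` [set _ | U x0])).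
  apply: measurableU; apply: measurableI => //.
  - by apply: open_measurable; exact: open_interior.
  - exact: measurableC.
  have [h|h] := pselect (U x0).
    by rewrite (_ : [set _ | _] = setT)// -subTset.
  by rewrite (_ : [set _ | _] = set0)// -subset0.
apply/seteqP; split => t /=.
  move=> Ut; have [Dt|nDt] := pselect (D t).
    by left; split => //; apply: (T_cvg Dt); exact: open_nbhs_nbhs.
  by right; split=> //; rewrite -(T_outside nDt).
by move=> [[Dt /interior_subset]|[nDt]]; [exact|rewrite T_outside].
Qed.

Lemma measurable_ev (b : B) :
  measurable_fun [set: borel X] (fun y : borel X => ev b (y : X)).
Proof.
apply: (measurability (@RGenOInfty.G R) (RGenOInfty.measurableE R)) => //.
move=> _ [_ [c ->] <-]; rewrite setTI; apply: sub_sigma_algebra.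
by have /continuousP := @ev_continuous b; apply; exact: interval_open.
Qed.

(** The canonical measure on a pushforward depends on a proof of measurability,
    which is supplied here. *)
Definition image_measure : {measure set (borel X) -> \bar R} :=
  measure_function_pushforward__canonical__measure_function_Measure
    (mrestr mu mD) measurable_T.

Lemma image_measureE A : image_measure A = mu (T @^-1` A `&` D).
Proof. by []. Qed.

Hypothesis muD : mu D = 1%E.

(** Inner regularity of Lebesgue measure is transported by [T], because continuous
    images of compact sets are compact. *)
Lemma image_measure_radon : is_radon image_measure.
Proof.
split=> [x|E mE].
  exists setT; first by split => //; exact: openT.
  by rewrite image_measureE preimage_setT setTI muD ltry.
have mTE : measurable (T @^-1` E `&` D).
  by apply: measurableI => //; rewrite -[X in measurable X]setTI; exact: measurable_T.
apply/eqP; rewrite eq_le; apply/andP; split.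
  rewrite image_measureE lebesgue_regularity_inner_sup//.
  apply: ge_ereal_sup => _ [K [cK KE] <-].
  have KD : K `<=` D by move=> t /KE[].
  apply: (@le_trans _ _ (image_measure (T @` K))).
    rewrite image_measureE; apply: le_outer_measure.
    by move=> t Kt; split; [exists t|exact: KD].
  apply: ereal_sup_ubound; exists (T @` K) => //; split.
    exact: continuous_compact (T_continuous KD) cK.
  by move=> _ [t /KE[] ? _ <-].
apply: ge_ereal_sup => _ [K [cK KE] <-].
apply: le_measure; rewrite ?inE//.
rewrite -[K]setCK; apply: measurableC; apply: sub_sigma_algebra.
by rewrite openC; apply: compact_closed cK; exact: hausdorff_character_space.
Qed.

Variable l : B -> R.
(** [l] behaves like a linear functional with [l 1 = 1] that is evaluated at
    squares. *)
Hypothesis l_shift : forall b c,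
  l ((b + c%:A) ^+ 2) = l (b ^+ 2) + 2 * c * l b + c ^+ 2.
Hypothesis T_fatou : forall b,
  (\int[mu]_(t in D) ((ev b (T t)) ^+ 2)%:E <= (l (b ^+ 2))%:E)%E.

Let m : {measure set (measurableTypeR R) -> \bar R} := mrestr mu mD.

Let m1 : m setT = 1%E.
Proof. by rewrite /m/= /mrestr setTI. Qed.

Let mevT b : measurable_fun [set: R] (fun t => ev b (T t)).
Proof. exact: measurableT_comp (@measurable_ev b) measurable_T. Qed.

Let integral_sq b : (\int[m]_t ((ev b (T t)) ^+ 2)%:E <= (l (b ^+ 2))%:E)%E.
Proof.
have mf E : measurable_fun E (fun t => ((ev b (T t)) ^+ 2)%:E).
  by apply: measurable_funTS; apply/measurable_EFinP; apply: measurable_funX; exact: mevT.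
have mCD : measurable (~` D) by exact: measurableC.
rewrite -(setUv D) ge0_integral_setU//; last 3 first.
- by rewrite setUv; exact: mf.
- by move=> t _; rewrite lee_fin sqr_ge0.
- by apply/disj_setPS => t [].
rewrite [X in (_ + X)%E]null_set_integral//; last 2 first.
- exact: mf.
- by rewrite /m/= /mrestr setICl.
rewrite adde0 (eq_measure_integral mu)//.
by move=> A mA AD; rewrite /m/= /mrestr setIidl.
Qed.

Let integrable_ev b : m.-integrable setT (fun t => (ev b (T t))%:E).
Proof.
apply/integrableP; split; first by apply/measurable_EFinP; exact: mevT.
apply: (@le_lt_trans _ _ (\int[m]_t (((ev b (T t)) ^+ 2)%:E + 1%:E))%E).
  apply: ge0_le_integral => //.
  - by apply: measurableT_comp => //; apply/measurable_EFinP; exact: mevT.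
  - by apply/measurable_EFinP; apply: measurable_funD => //; apply: measurable_funX; exact: mevT.
  - move=> t _; rewrite -EFinD lee_fin.
    have := sqr_ge0 (`|ev b (T t)| - 1).
    rewrite -[X in _ -> _ <= X + _](real_normK (num_real _)); nra.
rewrite ge0_integralD//; last 2 first.
- by move=> t _; rewrite lee_fin sqr_ge0.
- by apply/measurable_EFinP; apply: measurable_funX; exact: mevT.
rewrite integral_cst// m1 mule1 (le_lt_trans (leeD2r _ (integral_sq b)))//.
by rewrite -EFinD ltry.
Qed.

(** The bound on the second moments determines the first moments: its instances at
    [b + c] for all real [c] say that the affine function
    [v - l (b ^+ 2) + 2 * c * (u - l b)] of [c] is nowhere positive, where [u] and [v]
    are the first two moments of [b]. Its slope is therefore zero. *)
Let integral_ev b : (\int[m]_t (ev b (T t))%:E = (l b)%:E)%E.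
Proof.
have fin1 := integrable_fin_num measurableT (integrable_ev b).
have isq : m.-integrable setT (fun t => ((ev b (T t)) ^+ 2)%:E).
  apply/integrableP; split.
    by apply/measurable_EFinP; apply: measurable_funX; exact: mevT.
  under eq_integral do rewrite gee0_abs ?lee_fin ?sqr_ge0//.
  by rewrite (le_lt_trans (integral_sq b))// ltry.
have fin2 := integrable_fin_num measurableT isq.
rewrite -(fineK fin1); congr (_%:E).
set u := fine _; set v := fine (\int[m]_t ((ev b (T t)) ^+ 2)%:E)%E.
have key c : v + 2 * c * u + c ^+ 2 <= l (b ^+ 2) + 2 * c * l b + c ^+ 2.
  rewrite -l_shift -lee_fin; apply: le_trans (integral_sq _).
  rewrite le_eqVlt; apply/orP; left; apply/eqP.
  transitivity (\int[m]_t (((ev b (T t)) ^+ 2)%:E +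
      ((2 * c)%:E * (ev b (T t))%:E + (c ^+ 2)%:E)))%E; last first.
    apply: eq_integral => t _; rewrite -EFinM -!EFinD; congr (_%:E).
    by rewrite /ev linearD linearZ rmorph1 /= mulr1; lra.
  have i2 : m.-integrable setT (fun t => ((2 * c)%:E * (ev b (T t))%:E)%E).
    exact: integrableZl.
  have i3 : m.-integrable setT (fun=> (c ^+ 2)%:E).
    apply/integrableP; split => //.
    by rewrite integral_cst// m1 mule1 ltry.
  rewrite integralD//; last exact: integrableD.
  rewrite integralD// integralZl// integral_cst// m1 mule1.
  by rewrite -(fineK fin1) -(fineK fin2) -/u -/v -EFinM -!EFinD addrA.
apply/eqP; rewrite -subr_eq0; apply/eqP.
set dl := u - l b; apply: contrapT => /eqP dl0.
have := key ((`|v - l (b ^+ 2)| + 1) / (2 * dl)).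
set c := _ / _; have cE : 2 * c * dl = `|v - l (b ^+ 2)| + 1.
  by rewrite /c mulrAC mulrA [_ * (2 * dl)^-1]mulrC mulKf// mulf_neq0.
have := ler_norm (l (b ^+ 2) - v); rewrite distrC.
move: cE; rewrite /dl; lra.
Qed.

Lemma image_measure_representing : is_representing_radon l image_measure.
Proof.
split; first exact: image_measure_radon.
move=> b; have mev : measurable_fun setT (fun y : borel X => (ev b (y : X))%:E).
  by apply/measurable_EFinP; exact: measurable_ev.
split.
  exact: (@integrable_pushforward _ _ _ _ _ _ measurable_T m setT _ mev
    (integrable_ev b) measurableT).
rewrite -integral_ev; symmetry.
exact: (@integral_pushforward _ _ _ _ _ _ measurable_T m setT _ mev
  (integrable_ev b) measurableT).
Qed.

End RadonImage.

(** * Sums, spans and Fourier expansions *)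

Section Sums.
Context {R : realType}.

Lemma cauchy_schwarz_sum (I : Type) (r : seq I) (a b : I -> R) :
  (\sum_(i <- r) a i * b i) ^+ 2 <=
  (\sum_(i <- r) a i ^+ 2) * (\sum_(i <- r) b i ^+ 2).
Proof.
elim: r => [|i r]; first by rewrite !big_nil expr0n mul0r.
rewrite !big_cons; set S := \sum_(_ <- _) _ * _.
have P0 : 0 <= \sum_(j <- r) a j ^+ 2 by apply: sumr_ge0 => j _; exact: sqr_ge0.
have Q0 : 0 <= \sum_(j <- r) b j ^+ 2 by apply: sumr_ge0 => j _; exact: sqr_ge0.
move: P0 Q0; set P := \sum_(_ <- _) a _ ^+ 2; set Q := \sum_(_ <- _) b _ ^+ 2 => P0 Q0 ih.
set x := a i; set y := b i.
(* the arithmetic-geometric mean inequality for P * y ^+ 2 and Q * x ^+ 2 *)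
suff : 2 * S * x * y <= P * y ^+ 2 + Q * x ^+ 2 by lra.
have rhs0 : 0 <= P * y ^+ 2 + Q * x ^+ 2 by rewrite addr_ge0// mulr_ge0// sqr_ge0.
apply: le_trans (ler_norm _) _; rewrite -(ger0_norm rhs0) -ler_sqr ?nnegrE//.
rewrite !real_normK ?num_real//.
have := sqr_ge0 (P * y ^+ 2 - Q * x ^+ 2).
have : S ^+ 2 * (x * y) ^+ 2 <= P * Q * (x * y) ^+ 2 by rewrite ler_wpM2r// sqr_ge0.
lra.
Qed.

Lemma weighted_cauchy_schwarz (I : Type) (r : seq I) (w c y : I -> R) :
  (forall i, 0 < w i) ->
  `|\sum_(i <- r) c i * y i| <=
  Num.sqrt (\sum_(i <- r) w i ^- 2 * c i ^+ 2) *
  Num.sqrt (\sum_(i <- r) w i ^+ 2 * y i ^+ 2).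
Proof.
move=> w0; rewrite -sqrtr_sqr -sqrtrM; last first.
  by apply: sumr_ge0 => i _; rewrite mulr_ge0 ?invr_ge0 ?sqr_ge0.
rewrite ler_wsqrtr// (eq_bigr (fun i => ((w i)^-1 * c i) * (w i * y i))); last first.
  by move=> i _; rewrite mulrACA mulVf ?mul1r// gt_eqF.
rewrite (eq_bigr (fun i => ((w i)^-1 * c i) ^+ 2) (P := xpredT) (F1 := fun i => w i ^- 2 * _)).
  rewrite [X in _ * X](eq_bigr (fun i => (w i * y i) ^+ 2)).
    exact: cauchy_schwarz_sum.
  by move=> i _; rewrite exprMn.
by move=> i _; rewrite exprMn exprVn.
Qed.

Variable u : nat -> R.
Hypothesis u0 : forall n, 0 <= u n.
Hypothesis u_fin : (\sum_(0 <= n <oo) (u n)%:E < +oo)%E.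

Lemma partial_sum_le N : \sum_(n < N) u n <= fine (\sum_(0 <= n <oo) (u n)%:E)%E.
Proof.
rewrite -lee_fin fineK; last first.
  by rewrite ge0_fin_numE//; apply: nneseries_ge0 => n _ _; rewrite lee_fin.
rewrite -sumEFin -(big_mkord xpredT (fun n => (u n)%:E)).
by apply: nneseries_lim_ge => n _ _; rewrite lee_fin.
Qed.

Lemma tail_sum_small eps : 0 < eps ->
  exists N, forall M, \sum_(N <= n < M) u n <= eps.
Proof.
move=> eps0.
have /fine_cvg/cvgrPdist_le/(_ _ eps0)[N _ h] :=
  nneseries_tail_cvg u_fin (fun n _ => u0 n).
exists N => M; have := h N (leqnn _) => /=; rewrite sub0r normrN.
have tail_fin : (\sum_(N <= n <oo) (u n)%:E)%E \is a fin_num.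
  rewrite ge0_fin_numE; last by apply: nneseries_ge0 => n _ _; rewrite lee_fin.
  apply: le_lt_trans u_fin; rewrite (@nneseries_split _ _ 0 N); last first.
    by move=> n _; rewrite lee_fin.
  by rewrite add0n leeDr// sume_ge0// => n _; rewrite lee_fin.
move=> /(le_trans (ler_norm _)); apply: le_trans.
rewrite -lee_fin fineK// -sumEFin.
by apply: nneseries_lim_ge => n _ _; rewrite lee_fin.
Qed.

End Sums.

Section Subspaces.
Context {R : realType} {A : comAlgType R}.

Lemma linear_span_subspace (E : set A) : is_subspace (linear_span E).
Proof.
split=> [|k u v]; rewrite !inE.
  by move=> S [[S0 _] _]; rewrite inE in S0.
move=> Eu Ev S SE; have [[_ Sl] _] := SE.
by have := Sl k u v; rewrite !inE; apply; [exact: Eu|exact: Ev].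
Qed.

Lemma sub_linear_span (E : set A) : E `<=` linear_span E.
Proof. by move=> x Ex S [_]; apply. Qed.

Lemma linear_span_min (E W : set A) : is_subspace W -> E `<=` W -> linear_span E `<=` W.
Proof. by move=> sW EW x; apply. Qed.

Lemma sub_generated (W : set A) (x : A) : W x -> x \in generated W.
Proof. by move=> Wx; rewrite inE => S [_]; apply. Qed.

Lemma generated_ind (W : set A) (Q : A -> Prop) :
  (forall x, W x -> Q x) -> Q 1 -> (forall k a b, Q a -> Q b -> Q (k *: a + b)) ->
  (forall a b, Q a -> Q b -> Q (a * b)) ->
  forall b, b \in generated W -> Q b.
Proof.
move=> QW Q1 Ql Qm b; rewrite inE => /(_ Q); apply; split => //.
split=> [|k u v|u v]; rewrite !inE //; [exact: Ql|exact: Qm].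
Qed.

End Subspaces.

Section Weighted.
Context {R : realType} {A : comAlgType R} (V : set A) (V_subspace : is_subspace V).
Context (L : {scalar A}) (L_pos : forall a : A, 0 <= L (a ^+ 2)).
Context (e : nat -> A) (e_inj : injective e).
Context (e_cos : complete_orthonormal_system (s_form L) V (range e)).
Context (lambda : nat -> R) (lambda_gt0 : forall n, 0 < lambda n).

Local Notation U := (weighted_space L V e lambda).

Lemma L_ee n m : L (e n * e m) = (n == m)%:R.
Proof.
have [_ [orth norm1] _] := e_cos.
case: eqVneq => [<-|nm]; last first.
  by apply: orth; [exists n|exists m|move/e_inj => nm'; rewrite nm' eqxx in nm].
have := norm1 (e n) (ex_intro2 _ _ n Logic.I erefl).
rewrite /hilbert_seminorm /s_form => h.
rewrite -[LHS]sqr_sqrtr ?h ?expr1n//.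
by have := L_pos (e n); rewrite expr2.
Qed.

Definition fourier_coef (u : A) (n : nat) : R := L (u * e n).

Definition fourier_sum (u : A) (N : nat) : A := \sum_(n < N) fourier_coef u n *: e n.

Lemma fourier_coef_linear k a b n :
  fourier_coef (k *: a + b) n = k * fourier_coef a n + fourier_coef b n.
Proof. by rewrite /fourier_coef mulrDl -scalerAl linearP. Qed.

Lemma fourier_sum_linear k a b N :
  fourier_sum (k *: a + b) N = k *: fourier_sum a N + fourier_sum b N.
Proof.
rewrite /fourier_sum scaler_sumr -big_split /=; apply: eq_bigr => n _.
by rewrite fourier_coef_linear scalerDl scalerA.
Qed.

Lemma L_fourier_sum u N : L (u * fourier_sum u N) = \sum_(n < N) fourier_coef u n ^+ 2.
Proof.
rewrite /fourier_sum mulr_sumr linear_sum /=; apply: eq_bigr => n _.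
by rewrite -scalerAr linearZ /= expr2.
Qed.

Lemma fourier_coef_fourier_sum u N n : (n < N)%N ->
  fourier_coef (fourier_sum u N) n = fourier_coef u n.
Proof.
move=> nN; rewrite /fourier_coef /fourier_sum mulr_suml linear_sum /=.
rewrite (bigD1 (Ordinal nN))//= -scalerAl linearZ /= L_ee eqxx mulr1.
rewrite big1 ?addr0// => j jn; rewrite -scalerAl linearZ /= L_ee.
rewrite (_ : (_ == _) = false) ?mulr0//.
by apply: contraNF jn => /eqP jn; apply/eqP/val_inj.
Qed.

(** The partial Fourier sum is the orthogonal projection on the span of the first
    [N] vectors. *)
Lemma bessel u N :
  L ((u - fourier_sum u N) ^+ 2) = L (u ^+ 2) - \sum_(n < N) fourier_coef u n ^+ 2.
Proof.
have pp : L (fourier_sum u N * fourier_sum u N) = \sum_(n < N) fourier_coef u n ^+ 2.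
  rewrite {2}/fourier_sum mulr_sumr linear_sum /=; apply: eq_bigr => n _.
  by rewrite -scalerAr linearZ /= -/(fourier_coef _ _) fourier_coef_fourier_sum// expr2.
rewrite sqrrB mulr2n [fourier_sum u N ^+ 2]expr2 !linearD !linearN /= pp L_fourier_sum; lra.
Qed.

(** The equality is in the algebra and not only for the seminorm. *)
Lemma fourier_sum_span w : linear_span (range e) w ->
  exists N0, forall N, (N0 <= N)%N -> fourier_sum w N = w.
Proof.
pose Z := [set w | exists N0, forall N, (N0 <= N)%N -> fourier_sum w N = w].
apply: (@linear_span_min _ _ _ Z).
  split=> [|k u v]; rewrite !inE /=.
    exists 0%N => N _; rewrite /fourier_sum big1// => n _.
    by rewrite /fourier_coef mul0r linear0 scale0r.
  move=> [N1 h1] [N2 h2]; exists (maxn N1 N2) => N; rewrite geq_max => /andP[/h1 e1 /h2 e2].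
  by rewrite fourier_sum_linear e1 e2.
move=> _ [n _ <-]; exists n.+1 => N nN.
rewrite /fourier_sum (bigD1 (Ordinal nN))//= /fourier_coef L_ee eqxx scale1r.
rewrite big1 ?addr0// => j jn; rewrite L_ee.
rewrite (_ : (_ == _) = false) ?scale0r//.
by apply: contraNF jn => /eqP jn; apply/eqP/val_inj.
Qed.

(** Let [w] in the span be close to [u]. Then [w] equals its Fourier sum from some
    [N] on, and the remainder of [u - w] is no longer than [u - w]. *)
Lemma fourier_sum_cvg u eps : V u -> 0 < eps ->
  exists N0, forall N, (N0 <= N)%N -> L ((u - fourier_sum u N) ^+ 2) <= eps.
Proof.
move=> Vu eps0; have [_ _ dense] := e_cos.
have d0 : 0 < Num.sqrt (eps / 2) by rewrite sqrtr_gt0 divr_gt0.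
have [w ws wu] := dense u Vu _ d0.
have [N0 pw] := fourier_sum_span ws; exists N0 => N /pw pwN.
have -> : u - fourier_sum u N = (u - w) - fourier_sum (u - w) N + (w - fourier_sum w N).
  have -> : fourier_sum u N = fourier_sum (u - w) N + fourier_sum w N.
    by rewrite -{1}[u](subrK w) -[u - w in LHS]scale1r fourier_sum_linear scale1r.
  by rewrite [RHS]addrACA subrK -opprD.
rewrite pwN subrr addr0 bessel (le_trans (_ : _ <= L ((u - w) ^+ 2)))//.
  by rewrite gerBl sumr_ge0// => n _; exact: sqr_ge0.
move: wu; rewrite /hilbert_seminorm /s_form -expr2 ltr_sqrt ?divr_gt0// => wu.
by apply/ltW/(lt_le_trans wu); lra.
Qed.

Lemma weighted_sum_term_ge0 n u : 0 <= lambda n ^- 2 * s_form L u (e n) ^+ 2.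
Proof. by rewrite mulr_ge0 ?sqr_ge0// invr_ge0 sqr_ge0. Qed.

Lemma weighted_space_subspace : is_subspace U.
Proof.
have [V0 Vl] := V_subspace; split=> [|k u v]; rewrite !inE.
  split; first by rewrite inE in V0.
  rewrite /weighted_sum eseries0 ?ltry// => n _ _.
  by rewrite /s_form mul0r linear0 expr0n mulr0.
move=> [Vu ultn] [Vv vlt]; split; first by have := Vl k u v; rewrite !inE; apply.
apply: (@le_lt_trans _ _ ((2 * k ^+ 2)%:E * weighted_sum L e lambda u +
    2%:E * weighted_sum L e lambda v)%E); last first.
  by apply: lte_add_pinfty; apply: lte_mul_pinfty => //; rewrite lee_fin// mulr_ge0 ?sqr_ge0.
have t0 n w : (0 <= (lambda n ^- 2 * s_form L w (e n) ^+ 2)%:E)%E.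
  rewrite lee_fin; exact: weighted_sum_term_ge0.
rewrite /weighted_sum -!nneseriesZl//.
rewrite -nneseriesD//; last 2 first.
- by move=> n _ _; rewrite mule_ge0// lee_fin mulr_ge0 ?sqr_ge0.
- by move=> n _ _; rewrite mule_ge0// lee_fin.
apply: lee_nneseries => n _ //.
rewrite -!EFinM -EFinD lee_fin.
have := fourier_coef_linear k u v n; rewrite /fourier_coef /s_form => ->.
have l0 : 0 <= lambda n ^- 2 by rewrite invr_ge0 sqr_ge0.
set x := L (u * _); set y := L (v * _); set z := lambda n ^- 2 in l0 *.
have -> : 2 * k ^+ 2 * (z * x ^+ 2) + 2 * (z * y ^+ 2) =
    z * (2 * (k * x) ^+ 2 + 2 * y ^+ 2) by lra.
by apply: ler_wpM2l => //; have := sqr_ge0 (k * x - y); lra.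
Qed.

Lemma weighted_space_e n : U (e n).
Proof.
have [eV _ _] := e_cos; split; first by apply: eV; exists n.
rewrite /weighted_sum (@nneseries_split _ _ 0 n.+1); last first.
  by move=> k _; rewrite lee_fin; exact: weighted_sum_term_ge0.
rewrite sumEFin eseries0 ?adde0 ?ltry// => k; rewrite add0n => nk _.
by rewrite /s_form L_ee ltn_eqF// expr0n mulr0.
Qed.

End Weighted.

(** * Values of elements of the algebra at characters of subalgebras *)

Section Truncation.
Context {R : realType} {A : comAlgType R} (S : subalgClosed A).

(** Elements outside the subalgebra are sent to 0, to have their values at the
    characters of the subalgebra defined everywhere. This is immaterial in the
    limit, where each element is eventually inside. *)
Definition truncate (b : A) : subalg S := insubd 0 b.

Lemma truncateK (b : A) : b \in S -> subalg_incl (truncate b) = b.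
Proof. exact: insubdK. Qed.

Lemma truncate_eq (b : A) (c : subalg S) : b = subalg_incl c -> truncate b = c.
Proof. by move=> ->; exact: valKd. Qed.

End Truncation.

Section Evaluation.
Context {R : realType} {A : comAlgType R} (X0 : [set: character A] !=set0).
Context {I : Type} (S : I -> subalgClosed A) (L : {scalar A}) (L1 : L 1 = 1).

Local Notation X i := (character_space (restrict_nonempty (S i) X0)).

Definition sections_display (i : I) : measure_display := (@open (X i)).-sigma.

Definition sections (i : I) : measurableType (sections_display i) := borel (X i).

Context (nu : forall i, {measure set (sections i) -> \bar R}).
Hypothesis nuP : forall i, is_representing_radon (L \o @subalg_incl R A (S i)) (nu i).

Definition value (b : A) (w : {i & sections i}) : R :=
  (projT2 w : character (subalg (S (projT1 w)))) (truncate (S (projT1 w)) b).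

Implicit Types (w : {i & sections i}) (i : I).

Lemma value_linear k a b w : a \in S (projT1 w) -> b \in S (projT1 w) ->
  value (k *: a + b) w = k * value a w + value b w.
Proof.
case: w => i x /= Sa Sb; rewrite /value /= -linearP /=; congr (_ _).
by apply: truncate_eq; rewrite linearP /= !truncateK.
Qed.

Lemma valueM a b w : a \in S (projT1 w) -> b \in S (projT1 w) ->
  value (a * b) w = value a w * value b w.
Proof.
case: w => i x /= Sa Sb; rewrite /value /= -rmorphM /=; congr (_ _).
by apply: truncate_eq; rewrite rmorphM /= !truncateK.
Qed.

Lemma value1 w : value 1 w = 1.
Proof.
case: w => i x; rewrite /value /= -[RHS](rmorph1 (x : character (subalg (S i)))).
congr (_ _).
by apply: truncate_eq; rewrite rmorph1.
Qed.

Lemma measurable_value i b :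
  measurable_fun [set: sections i] (fun x => value b (existT _ i x)).
Proof. exact: (@measurable_ev R _ (restrict_nonempty (S i) X0) (truncate (S i) b)). Qed.

Lemma integral_value_sq i b : b \in S i ->
  (\int[nu i]_x ((value b (existT _ i x)) ^+ 2)%:E = (L (b ^+ 2))%:E)%E.
Proof.
move=> Sb; have [_ /(_ ((truncate (S i) b) ^+ 2))[_]] := nuP i.
rewrite /= rmorphXn /= truncateK// => ->.
by apply: eq_integral => x _; rewrite /ev rmorphXn.
Qed.

Lemma nu_setT i : nu i setT = 1%E.
Proof.
have [_ /(_ 1)[_]] := nuP i; rewrite /= rmorph1 L1 => ->.
rewrite -[LHS]mul1e -(integral_cst (nu i) measurableT).
by apply: eq_integral => x _; rewrite /ev rmorph1.
Qed.

Lemma value_sum i (x : sections i) N (c : nat -> R) (e : nat -> A) :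
  (forall n, (n < N)%N -> e n \in S i) ->
  value (\sum_(n < N) c n *: e n) (existT _ i x) =
  \sum_(n < N) c n * value (e n) (existT _ i x).
Proof.
elim: N => [|N ih] Se.
  rewrite !big_ord0; have := @value_linear (-1) 1 1 (existT _ i x).
  by rewrite scaleN1r addNr mulN1r addNr; apply; exact: rpred1.
rewrite !big_ord_recr /= addrC value_linear ?Se//; last first.
  by apply: rpred_sum => n _; rewrite rpredZ// Se// (ltn_trans (ltn_ord n)).
by rewrite ih 1?[RHS]addrC// => n nN; rewrite Se// (ltn_trans nN).
Qed.

End Evaluation.

(** * The random character *)

Section Approximants.
Context {R : realType} {A : comAlgType R} (X0 : [set: character A] !=set0).
Context (V : set A) (V_subspace : is_subspace V).
Context (L : {scalar A}) (L1 : L 1 = 1) (L_pos : forall a : A, 0 <= L (a ^+ 2)).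
Context (e : nat -> A) (e_inj : injective e).
Context (e_cos : complete_orthonormal_system (s_form L) V (range e)).
Context (lambda : nat -> R) (lambda_gt0 : forall n, 0 < lambda n).
Context (lambda_sum : (\sum_(0 <= n <oo) (lambda n ^+ 2)%:E < +oo)%E).

Local Notation U := (weighted_space L V e lambda).

(** A stage [(s, N)] stands for the subspace spanned by the elements of [s] that lie
    in [U] and by [e 0], ..., [e (N - 1)]. Keeping track of [N] lets random variables
    such as [energy] and [residue] sum over a number of terms that grows with the
    stage; it is not determined by the subalgebra, which may contain infinitely many
    of the [e n]. *)
Definition stage := (seq A * nat)%type.

Definition spanning_seq (i : stage) : seq A :=
  [seq x <- i.1 | x \in U] ++ [seq e n | n <- iota 0 i.2].

Definition approximant (i : stage) : subalgClosed A :=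
  generated (linear_span [set` spanning_seq i]).

Local Notation S := approximant.

Lemma approximant_fin_dim i : fin_dim_generated U (S i).
Proof.
exists (linear_span [set` spanning_seq i]) => //; split.
  by split; [exact: linear_span_subspace|exists (spanning_seq i)].
apply: linear_span_min; first exact: weighted_space_subspace.
move=> x; rewrite /= mem_cat mem_filter => /orP[/andP[/set_mem//]|/mapP[n _ ->]].
exact: weighted_space_e.
Qed.

Definition stage_tails : set_system stage :=
  [set Q | exists (s0 : seq A) (N0 : nat),
    forall (s : seq A) (N : nat), {subset s0 <= s} -> (N0 <= N)%N -> Q (s, N)].

Lemma stage_tails_proper : ProperFilter stage_tails.
Proof.
apply: Build_ProperFilter_ex => [Q [s [N /(_ s N (fun _ => id) (leqnn _))]]|].
  by exists (s, N).
split.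
- by exists [::], 0%N.
- move=> P Q [s1 [N1 h1]] [s2 [N2 h2]]; exists (s1 ++ s2), (maxn N1 N2) => s N ss.
  rewrite geq_max => /andP[l1 l2]; split; [apply: h1|apply: h2] => // x xs; apply: ss;
    by rewrite mem_cat xs ?orbT.
- by move=> P Q PQ [s [N h]]; exists s, N => s' N' h1 h2; apply/PQ/h.
Qed.

Lemma stage_tails_ge N : stage_tails [set i | (N <= i.2)%N].
Proof. by exists [::], N. Qed.

Lemma sub_generated_span i x : x \in spanning_seq i -> x \in S i.
Proof.
move=> xi; apply: sub_generated.
exact: (@sub_linear_span _ _ [set` spanning_seq i] _ xi).
Qed.

Lemma approximant_e i n : (n < i.2)%N -> e n \in S i.
Proof.
move=> ni; apply: sub_generated_span.
by rewrite mem_cat map_f ?orbT// mem_iota.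
Qed.

Lemma stage_tails_mem b : b \in generated U -> stage_tails [set i | b \in S i].
Proof.
have FF := stage_tails_proper.
move: b; apply: generated_ind => [x Ux||k a b|a b].
- exists [:: x], 0%N => s N /(_ x (mem_head _ _)) xs _.
  by apply: sub_generated_span; rewrite mem_cat mem_filter xs mem_set.
- by apply: filterS filterT => i _ /=; rewrite rpred1.
- by apply: filterS2 => i /= Sa Sb; rewrite rpredD// rpredZ.
- by apply: filterS2 => i /= Sa Sb; rewrite rpredM.
Qed.

Context (F : set_system stage) {FU : UltraFilter F} (tailsF : stage_tails `<=` F).
Context (nu : forall i, {measure set (sections X0 S i) -> \bar R}).
Hypothesis nuP : forall i, is_representing_radon (L \o @subalg_incl R A (S i)) (nu i).

Local Notation Om := {i & sections X0 S i}.
Local Notation value := (@value R A X0 stage S).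
Local Notation pr := (mass F nu (fun=> 1)).
Local Notation Ev := (@internal stage _ (sections X0 S)).

(** Its mean is at most the sum of the squares of [lambda], hence it is bounded with
    a probability close to one. This is where the hypothesis that the embedding of
    the weighted space is of Hilbert-Schmidt type enters. *)
Definition energy (w : Om) : R :=
  \sum_(n < (projT1 w).2) lambda n ^+ 2 * value (e n) w ^+ 2.

Definition residue (u : A) (w : Om) : R :=
  value u w - \sum_(n < (projT1 w).2) fourier_coef L e u n * value (e n) w.

Lemma internal_lt (f : Om -> R) c :
  (forall i, measurable_fun setT (fun x : sections X0 S i => f (existT _ i x))) ->
  Ev [set w | c < f w].
Proof.
move=> mf i; rewrite -[X in measurable X]setTI.
by rewrite (_ : _ @^-1` _ = (fun x : sections X0 S i => f (existT _ i x)) @^-1` `]c, +oo[);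
  [exact: mf|apply/seteqP; split => x /=; rewrite in_itv/= andbT].
Qed.

Lemma internal_le (f : Om -> R) c :
  (forall i, measurable_fun setT (fun x : sections X0 S i => f (existT _ i x))) ->
  Ev [set w | f w <= c].
Proof.
move=> mf i; rewrite -[X in measurable X]setTI.
by rewrite (_ : _ @^-1` _ = (fun x : sections X0 S i => f (existT _ i x)) @^-1` `]-oo, c]);
  [exact: mf|apply/seteqP; split => x /=; rewrite in_itv/=].
Qed.

Lemma energy_ge0 w : 0 <= energy w.
Proof. by apply: sumr_ge0 => n _; rewrite mulr_ge0 ?sqr_ge0. Qed.

Let mvalue i b := @measurable_value R A X0 stage S i b.

Lemma measurable_energy i :
  measurable_fun setT (fun x : sections X0 S i => energy (existT _ i x)).
Proof.
rewrite /energy /=; apply: measurable_sum => n; apply: measurable_funM => //.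
by apply: measurable_funX; exact: mvalue.
Qed.

Lemma measurable_residue u i :
  measurable_fun setT (fun x : sections X0 S i => residue u (existT _ i x)).
Proof.
rewrite /residue /=; apply: measurable_funB; first exact: mvalue.
by apply: measurable_sum => n; apply: measurable_funM => //; exact: mvalue.
Qed.

Definition Lambda : R := fine (\sum_(0 <= n <oo) (lambda n ^+ 2)%:E)%E.

Lemma integral_energy i : (\int[nu i]_x (energy (existT _ i x))%:E <= Lambda%:E)%E.
Proof.
rewrite (_ : (\int[nu i]_x _)%E = (\sum_(n < i.2) (lambda n ^+ 2)%:E)%E).
  by rewrite sumEFin lee_fin; apply: partial_sum_le => // n; exact: sqr_ge0.
rewrite (eq_integral (fun x : sections X0 S i =>
    \sum_(n < i.2) (lambda n ^+ 2 * value (e n) (existT _ i x) ^+ 2)%:E)%E); last first.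
  by move=> x _; rewrite sumEFin.
rewrite ge0_integral_sum//; last 2 first.
- move=> n; apply/measurable_EFinP; apply: measurable_funM => //.
  by apply: measurable_funX; exact: mvalue.
- by move=> n x _; rewrite lee_fin mulr_ge0 ?sqr_ge0.
apply: eq_bigr => n _; under eq_integral do rewrite EFinM.
rewrite ge0_integralZl//; last 3 first.
- by apply/measurable_EFinP; apply: measurable_funX; exact: mvalue.
- by move=> x _; rewrite lee_fin sqr_ge0.
- by rewrite lee_fin sqr_ge0.
rewrite (integral_value_sq nuP) ?approximant_e//.
by rewrite expr2 (L_ee L_pos e_inj e_cos) eqxx mule1.
Qed.

Lemma residueE u (w : Om) : u \in S (projT1 w) ->
  residue u w = value (u - fourier_sum L e u (projT1 w).2) w.
Proof.
case: w => i x /= Su; rewrite /residue /=.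
have Se n : (n < i.2)%N -> e n \in S i by exact: approximant_e.
rewrite -(value_sum x _ Se) -/(fourier_sum L e u i.2).
have -> : u - fourier_sum L e u i.2 = (-1) *: fourier_sum L e u i.2 + u.
  by rewrite scaleN1r addrC.
rewrite value_linear//=; last first.
  by apply: rpred_sum => n _; rewrite rpredZ// Se.
by rewrite mulN1r addrC.
Qed.

Lemma integral_residue_sq u eps : U u -> 0 < eps ->
  \forall i \near F, (\int[nu i]_x ((residue u (existT _ i x)) ^+ 2)%:E <= eps%:E)%E.
Proof.
move=> Uu eps0.
have [N0 hN] := fourier_sum_cvg L_pos e_inj e_cos Uu.1 eps0.
apply: filterS2 (tailsF (stage_tails_ge N0))
  (tailsF (stage_tails_mem (sub_generated Uu))).
move=> i /= Ni Su.
under eq_integral do rewrite residueE//=.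
rewrite (integral_value_sq nuP) ?lee_fin ?hN//.
rewrite rpredB//; apply: rpred_sum => n _; rewrite rpredZ//.
by apply: approximant_e.
Qed.

(** Whether the energy is at most [r], and on which side of each rational number
    the value at each [e m] lies. *)
Definition questions (k : nat) : set Om :=
  match (unpickle k : option (nat + nat * rat)%type) with
  | Some (inl r) => [set w | energy w <= r%:R]
  | Some (inr (m, q)) => [set w | ratr q < value (e m) w]
  | None => setT
  end.

Lemma Ev_questions k : Ev (questions k).
Proof.
rewrite /questions; case: unpickle => [[r|[m q]]|]; last exact: internalT.
  by apply: internal_le => i; exact: measurable_energy.
by apply: internal_lt => i; exact: mvalue.
Qed.

Let nu1 i : nu i setT = 1%E. Proof. exact: (nu_setT L1 nuP). Qed.

Let prC : is_content Ev pr. Proof. exact: limit_pr_content nu1. Qed.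

Let pr1 : pr setT = 1. Proof. exact: limit_prT nu1. Qed.

Let EvT : Ev setT. Proof. exact: internalT. Qed.

Let EvI : forall E G, Ev E -> Ev G -> Ev (E `&` G). Proof. exact: internalI. Qed.

Let EvD : forall E G, Ev E -> Ev G -> Ev (E `\` G). Proof. exact: internalD. Qed.

Local Notation FT := (branch_filter Ev pr questions).

#[local] Instance FT_filter t : Filter (FT t).
Proof. exact: (branch_filter_filter questions EvT EvI EvD prC t). Qed.

Lemma near_stage (Z : set stage) t : F Z -> FT t [set w : Om | Z (projT1 w)].
Proof.
move=> FZ; have [iZ Z0] := limit_pr_near nu FZ.
by apply: filterS (branch_filter_null questions t iZ Z0) => w /contrapT.
Qed.

(** The second moment of the residue tends to 0 by completeness of the orthonormal
    system, so large residues are null events. This holds along every branch, for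
    each of the possibly uncountably many [u]. *)
Lemma near_residue u eps t : U u -> 0 < eps -> FT t [set w | `|residue u w| <= eps].
Proof.
move=> Uu eps0.
have mr i : measurable_fun setT (fun x : sections X0 S i => residue u (existT _ i x) ^+ 2).
  by apply: measurable_funX; exact: measurable_residue.
have iN := internal_lt (f := fun w => residue u w ^+ 2) (eps ^+ 2) mr.
have e2 : 0 < eps ^+ 2 by rewrite exprn_gt0.
have N0 : pr [set w | eps ^+ 2 < residue u w ^+ 2] = 0.
  apply/eqP; rewrite eq_le prC.1// andbT -(@ler_pM2l _ (eps ^+ 2))// mulr0.
  apply/ler_addgt0Pr => c c0; rewrite add0r.
  apply: (pr_markov nu1 (f := fun w => residue u w ^+ 2)) => //.
  - by move=> w; exact: sqr_ge0.
  - exact: integral_residue_sq.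
  - by move=> w /ltW.
apply: filterS (branch_filter_null questions t iN N0) => w /=.
move=> /negP; rewrite -leNgt => h.
by rewrite -[leRHS]ger0_norm ?(ltW eps0)// -!sqrtr_sqr ler_wsqrtr.
Qed.

Definition bounded_energy (r : nat) (t : R) : Prop :=
  event (branch pr questions t (pickle (inl r : nat + nat * rat)).+1) `<=`
  [set w | energy w <= r%:R].

Lemma questions_energy r :
  questions (pickle (inl r : nat + nat * rat)) = [set w | energy w <= r%:R].
Proof. by rewrite /questions pickleK. Qed.

Lemma questions_value m q :
  questions (pickle (inr (m, q) : nat + nat * rat)) = [set w | ratr q < value (e m) w].
Proof. by rewrite /questions pickleK. Qed.

Section Branch.
Variables (t : R) (r : nat).
Hypothesis t01 : 0 <= t < 1.
Hypothesis tr : bounded_energy r t.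

#[local] Instance FT_proper : ProperFilter (FT t).
Proof. exact: (branch_filter_proper EvT EvI EvD prC pr1 Ev_questions t01). Qed.

Lemma near_energy : FT t [set w | energy w <= r%:R].
Proof.
apply: filterS tr _.
exact: (branch_filter_event questions EvT EvD prC).
Qed.

Lemma energy_value m w : (m < (projT1 w).2)%N ->
  lambda m ^+ 2 * value (e m) w ^+ 2 <= energy w.
Proof.
move=> mw; rewrite /energy (bigD1 (Ordinal mw))//= lerDl.
by apply: sumr_ge0 => n _; rewrite mulr_ge0 ?sqr_ge0.
Qed.

(** The bound on the energy keeps the values from escaping to infinity. *)
Lemma cvg_value_e m : cvg (value (e m) @ FT t).
Proof.
apply: (@decided_cvg _ _ _ _ (Num.sqrt (r%:R / lambda m ^+ 2))).
  apply: filterS2 near_energy (near_stage t (tailsF (stage_tails_ge m.+1))) => w /= wr mw.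
  rewrite -sqrtr_sqr ler_wsqrtr// ler_pdivlMr ?exprn_gt0// mulrC.
  exact: le_trans (energy_value mw) wr.
move=> q; rewrite -questions_value.
exact: (branch_filter_decided questions EvT EvI EvD prC t).
Qed.

(** Up to a residue that vanishes in the limit, the value at [u] is its finite
    Fourier expansion at the stage; by the Cauchy-Schwarz inequality the terms from
    [N] on contribute at most the square root of [r] times the tail of the weighted
    norm of [u]. The value is thus a uniform limit of values at combinations of the
    [e n]. *)
Lemma cvg_value_U u : U u -> cvg (value u @ FT t).
Proof.
move=> Uu; apply: uniform_limit_cvg => eps eps0.
have e2 : 0 < eps / 2 by rewrite divr_gt0.
pose c := fourier_coef L e u.
(* the tail of the weighted norm must beat the bound r on the energy *)
have d0 : 0 < (eps / 2) ^+ 2 / (r%:R + 1) by rewrite divr_gt0 ?exprn_gt0// ltr_wpDl.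
have [N hN] := tail_sum_small (fun n => weighted_sum_term_ge0 L e lambda n u) Uu.2 d0.
exists (fun w => \sum_(0 <= n < N) c n * value (e n) w); split.
  by apply: is_cvg_linear_combination => n; exact: cvg_value_e.
apply: filterS3 near_energy (near_stage t (tailsF (stage_tails_ge N)))
  (near_residue t Uu e2) => w /= wr Nw ru.
rewrite (_ : value u w - _ =
    residue u w + \sum_(N <= n < (projT1 w).2) c n * value (e n) w); last first.
  rewrite /residue -(big_mkord xpredT (fun n => c n * value (e n) w)).
  rewrite [X in _ = _ - X + _](big_cat_nat (n := N))//=.
  lra.
apply: le_trans (ler_normD _ _) _; rewrite [leRHS]splitr lerD//.
apply: le_trans (weighted_cauchy_schwarz _ _ _ lambda_gt0) _.
rewrite -sqrtrM ?sumr_ge0//; last by move=> n _; exact: weighted_sum_term_ge0.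
rewrite -[leRHS]ger0_norm ?(ltW e2)// -[leRHS]sqrtr_sqr ler_wsqrtr//.
rewrite -[leRHS](divfK (_ : r%:R + 1 != 0)) ?gt_eqF ?ltr_wpDl//.
apply: ler_pM; [|by apply: sumr_ge0 => n _; rewrite mulr_ge0 ?sqr_ge0|exact: hN|].
  by apply: sumr_ge0 => n _; exact: weighted_sum_term_ge0.
rewrite (@le_trans _ _ (energy w))//; last by rewrite (le_trans wr)// lerDl.
rewrite /energy -(big_mkord xpredT (fun n => lambda n ^+ 2 * value (e n) w ^+ 2)).
rewrite [leRHS](big_cat_nat (n := N))//= lerDr.
by apply: sumr_ge0 => n _; rewrite mulr_ge0 ?sqr_ge0.
Qed.

Lemma near_mem b : b \in generated U -> FT t [set w : Om | b \in S (projT1 w)].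
Proof. by move=> Ub; exact: near_stage (tailsF (stage_tails_mem Ub)). Qed.

(** At all late stages evaluation respects the operations of the algebra. *)
Lemma cvg_value b : b \in generated U -> cvg (value b @ FT t).
Proof.
move=> Ub; suff [] : cvg (value b @ FT t) /\ b \in generated U by [].
move: b Ub; apply: generated_ind => [x Ux||k a b [ca Ua] [cb Ub]|a b [ca Ua] [cb Ub]].
- by split; [exact: cvg_value_U|exact: sub_generated].
- split; last by rewrite rpred1.
  by apply/cvg_ex; exists 1; apply: cvg_near_cst; apply: nearW => w; rewrite value1.
- split; last by rewrite rpredD// rpredZ.
  apply/cvg_ex; exists (k * lim (value a @ FT t) + lim (value b @ FT t)).
  apply: cvg_trans; last exact: cvgD (cvgM (cvg_cst k) ca) cb.
  apply: near_eq_cvg; apply: filterS2 (near_mem Ua) (near_mem Ub) => w /= wa wb.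
  by rewrite value_linear.
- split; last by rewrite rpredM.
  apply/cvg_ex; exists (lim (value a @ FT t) * lim (value b @ FT t)).
  apply: cvg_trans; last exact: cvgM ca cb.
  apply: near_eq_cvg; apply: filterS2 (near_mem Ua) (near_mem Ub) => w /= wa wb.
  by rewrite valueM.
Qed.

Lemma lim_value_le u : U u ->
  `|lim (value u @ FT t)| <= Num.sqrt r%:R * weighted_norm L e lambda u.
Proof.
move=> Uu; apply/ler_addgt0Pr => eps eps0.
apply: cvgr_to_le (cvg_norm (cvg_value_U Uu)) _.
apply: filterS2 near_energy (near_residue t Uu eps0) => w /= wr ru.
rewrite (_ : value u w = residue u w +
  \sum_(n < (projT1 w).2) fourier_coef L e u n * value (e n) w); last first.
  by rewrite /residue subrK.
apply: le_trans (ler_normD _ _) _; rewrite addrC lerD//.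
apply: le_trans (weighted_cauchy_schwarz _ _ _ (fun n : 'I_(projT1 w).2 => lambda_gt0 n)) _.
rewrite mulrC ler_pM ?sqrtr_ge0// ler_wsqrtr//.
apply: (partial_sum_le (fun n => weighted_sum_term_ge0 L e lambda n u)).
exact: Uu.2.
Qed.

Local Notation B := (subalg (generated U)).

(** The algebraic relations between finitely many elements hold exactly at all late
    stages, hence for the limits. *)
Lemma branch_character : exists alpha : character B,
  forall b : B, value (subalg_incl b) @ FT t --> alpha b.
Proof.
have Ub (b : B) : subalg_incl b \in generated U by exact: valP.
pose f (b : B) : R := lim (value (subalg_incl b) @ FT t).
have fc b : value (subalg_incl b) @ FT t --> f b by exact: cvg_value.
have f1 : f 1 = 1.
  apply: cvg_lim => //; apply: cvg_near_cst; apply: nearW => w.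
  by rewrite rmorph1 value1.
have fl k a b : f (k *: a + b) = k * f a + f b.
  apply: cvg_lim => //; apply: cvg_trans; last exact: cvgD (cvgM (cvg_cst k) (fc a)) (fc b).
  apply: near_eq_cvg; apply: filterS2 (near_mem (Ub a)) (near_mem (Ub b)) => w /= wa wb.
  by rewrite linearP value_linear.
have fm a b : f (a * b) = f a * f b.
  apply: cvg_lim => //; apply: cvg_trans; last exact: cvgM (fc a) (fc b).
  apply: near_eq_cvg; apply: filterS2 (near_mem (Ub a)) (near_mem (Ub b)) => w /= wa wb.
  by rewrite rmorphM valueM.
pose F_lin := GRing.isLinear.Build R B R *%R f fl.
pose F_mul := GRing.isMonoidMorphism.Build B R f (conj f1 fm).
pose alpha : character B := HB.pack f F_lin F_mul.
by exists alpha.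
Qed.

End Branch.

Definition good_points : set R :=
  [set t | interior_points pr questions t /\ exists r, bounded_energy r t].

Lemma measurable_good_points : measurable good_points.
Proof.
rewrite (_ : good_points =
    interior_points pr questions `&` \bigcup_r [set t | bounded_energy r t]).
  apply: measurableI; first exact: measurable_interior_points.
  apply: bigcupT_measurable => r.
  exact: (measurable_branch_set pr questions
    (fun s => event s `<=` [set w | energy w <= r%:R])).
by apply/seteqP; split => [t [? [r ?]]|t [? [r _ ?]]]; split => //; exists r.
Qed.

Local Notation mu := (@lebesgue_measure R).

(** Almost every branch has bounded energy, by Markov. *)
Lemma lebesgue_good_points : mu good_points = 1%E.
Proof.
have mI := measurable_interior_points pr questions.
have mG := measurable_good_points.
have G01 : good_points `<=` `[0, 1[ by move=> t [[t01 _] _]; rewrite /= in_itv.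
have m01 : mu `[0, 1[ = 1%E.
  by rewrite lebesgue_measure_itv/= lte_fin ltr01 oppr0 adde0.
pose bad r := [set t : R | 0 <= t < 1 /\
  event (branch pr questions t (pickle (inl r : nat + nat * rat)).+1) `<=`
    ~` questions (pickle (inl r : nat + nat * rat))].
have bad_le r : (r%:R%:E * mu (bad r) <= Lambda%:E)%E.
  have := lebesgue_avoid EvT EvI EvD prC pr1 Ev_questions (pickle (inl r : nat + nat * rat)).
  move=> /(lee_wpmul2l (_ : (0 <= r%:R%:E)%E)) h.
  apply: le_trans (h _) _; first by rewrite lee_fin.
  rewrite -EFinM lee_fin questions_energy.
  apply: (pr_markov nu1 (f := energy)).
  - exact: energy_ge0.
  - exact: measurable_energy.
  - by apply: nearW => i; exact: integral_energy.
  - by apply: EvD => //; apply: internal_le => i; exact: measurable_energy.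
  - by move=> w [_ /negP]; rewrite -ltNge => /ltW.
(* the r-th bad set has measure at most Lambda / r *)
have bad0 : mu (\bigcap_r bad r) = 0%E.
  apply/eqP; rewrite eq_le outer_measure_ge0 andbT.
  apply/lee_addgt0Pr => eps eps0; rewrite add0e.
  have L0 : 0 <= Lambda / eps.
    rewrite divr_ge0 ?(ltW eps0)//; apply: fine_ge0; apply: nneseries_ge0 => n _ _.
    by rewrite lee_fin sqr_ge0.
  have := archi_boundP L0; set k := Num.bound _ => kL.
  have k0 : 0 < k%:R :> R by exact: le_lt_trans kL.
  apply: (@le_trans _ _ (mu (bad k))); first by apply: le_outer_measure => t; exact.
  rewrite -(@lee_pmul2l _ k%:R%:E) ?lte_fin//; apply: le_trans (bad_le k) _.
  by rewrite -EFinM lee_fin -ler_pdivrMr// ltW.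
have diff0 : mu (`[0, 1[ `\` good_points) = 0%E.
  apply/eqP; rewrite eq_le outer_measure_ge0 andbT.
  have int0 := lebesgue_interior_points EvT EvI EvD prC pr1 Ev_questions.
  rewrite -[leRHS](adde0 0%E) -{1}int0 -bad0.
  apply: le_trans (outer_measureU2 _ _ _); apply: le_outer_measure => t [t01 nt].
  have [ti|nti] := pselect (interior_points pr questions t); last by left.
  right => r _; split; first by move: t01; rewrite /= in_itv.
  case: (branch_decided pr questions t (pickle (inl r : nat + nat * rat))) => // h.
  exfalso; apply: nt; split => //; exists r.
  by move: h; rewrite questions_energy.
have mD : measurable (`[0, 1[%classic `\` good_points) by exact: measurableD.
rewrite -m01 -[X in _ = mu X](setDUK G01) measureU//.
  by rewrite [X in (_ + X)%E]diff0 adde0.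
by rewrite setDE setICA setICr setI0.
Qed.

Local Notation B := (subalg (generated U)).
Local Notation X0B := (restrict_nonempty (generated U) X0).
Local Notation XB := (character_space X0B).

Lemma representing_on_generated :
  exists nuB : {measure set (borel XB) -> \bar R},
    is_representing_radon (L \o @subalg_incl R A (generated U)) nuB /\
    nuB (~` [set alpha : character B |
      seminorm_continuous (@subalg_incl R A (generated U) @^-1` U)
        (weighted_norm L e lambda \o @subalg_incl R A (generated U)) alpha]) = 0%E.
Proof.
set M := [set alpha : character B | _].
pose iota := @subalg_incl R A (generated U).
have /choice[T TP] : forall t, exists x : XB,
    (good_points t -> forall b : B, value (iota b) @ FT t --> ev b x) /\
    (~ good_points t -> x = point).
  move=> t.
  have [tg|nt] := pselect (good_points t); last by exists point.
  have [[t01 _] [r tr]] := tg; have [alpha alphaP] := branch_character t01 tr.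
  by exists alpha.
have T_cvg t (tg : good_points t) := (TP t).1 tg.
have T_outside t (nt : ~ good_points t) := (TP t).2 nt.
have T_near t b eps : good_points t -> 0 < eps ->
    \forall t' \near t, good_points t' -> `|ev b (T t) - ev b (T t')| < eps.
  move=> tg eps0.
  have := branch_limit_near EvT EvI EvD prC pr1 Ev_questions tg.1 eps0 (T_cvg t tg b).
  apply: filterS => t' h t'g; apply: h; [exact: t'g.1.1|exact: T_cvg].
have mG := measurable_good_points.
exists (image_measure mG T_outside T_near); split.
  apply: image_measure_representing; first exact: lebesgue_good_points.
    move=> b c; have iD : iota (b + c%:A) = iota b + c%:A.
      by rewrite /iota rmorphD /= linearZ /= rmorph1.
    have iX x : (L \o iota) (x ^+ 2) = L (iota x ^+ 2) by rewrite /= /iota rmorphXn.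
    rewrite !iX iD [(L \o iota) b]/= sqrrD mulr2n -scalerAr mulr1.
    rewrite [c%:A ^+ 2]expr2 -[c%:A * _]scalerAl mul1r.
    by rewrite scalerA !linearD !linearZ /= L1; lra.
  move=> b; have Ub : iota b \in generated U by exact: valP.
  have f0 (w : Om) : 0 <= value (iota b) w ^+ 2 by exact: sqr_ge0.
  have mf i :
      measurable_fun setT (fun x : sections X0 S i => value (iota b) (existT _ i x) ^+ 2).
    by apply: measurable_funX; exact: mvalue.
  have fL : \forall i \near F,
      (\int[nu i]_x (value (iota b) (existT _ i x) ^+ 2)%:E <= (L (iota b ^+ 2))%:E)%E.
    by apply: filterS (tailsF (stage_tails_mem Ub)) => i Si; rewrite (integral_value_sq nuP).
  apply: (@le_trans _ _ (mass F nu (fun w => value (iota b) w ^+ 2) setT)%:E); last first.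
    by rewrite lee_fin /= rmorphXn; exact: mass_le f0 mf fL.
  apply: (fatou_branch EvT EvI EvD prC pr1 Ev_questions
    (Y := fun w => value (iota b) w ^+ 2)) => //.
  - exact: mass_content f0 mf fL.
  - move=> c E N iE iN N0 cY.
    exact: (mass_ge nu1 (f := fun w => value (iota b) w ^+ 2) f0 mf fL iE iN N0 cY).
  - by move=> t [[t01 _] _]; rewrite /= in_itv.
  - apply: measurable_funTS; apply: measurable_funX.
    exact: measurableT_comp (@measurable_ev _ _ X0B b) (measurable_T mG T_outside T_near).
  - by move=> t; exact: sqr_ge0.
  - by move=> t tg; exact: cvgM (T_cvg t tg b) (T_cvg t tg b).
rewrite image_measureE (_ : _ `&` _ = set0) ?measure0//.
rewrite -subset0 => t [/= nM tg]; apply: nM.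
have [[t01 _] [r tr]] := tg.
(* the constant must be positive, also when r = 0 *)
exists (Num.sqrt r%:R + 1); first by rewrite ltr_wpDl.
move=> v Uv.
have <- : lim (value (iota v) @ FT t) = T t v.
  have PF := FT_proper t01; apply: cvg_lim => //; exact: T_cvg.
apply: le_trans (lim_value_le t01 tr Uv) _.
by rewrite ler_wpM2r ?sqrtr_ge0// lerDl.
Qed.

End Approximants.

Theorem corollary2p19 (R : realType) (A : comAlgType R)
  (XA0 : [set: character A] !=set0)
  (V : set A) (V_subspace : is_subspace V) (V_generates : generates V)
  (L : {scalar A}) (L1 : L 1 = 1) (L_pos : forall a : A, 0 <= L (a ^+ 2))
  (e : nat -> A) (e_inj : injective e)
  (e_cos : complete_orthonormal_system (s_form L) V (range e))
  (lambda : nat -> R) (lambda_gt0 : forall n, 0 < lambda n)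
  (lambda_sum : (\sum_(0 <= n <oo) (lambda n ^+ 2)%:E < +oo)%E) :
  let U := weighted_space L V e lambda in
  let q := weighted_norm L e lambda in
  [set alpha : character A | seminorm_continuous U (s_norm L) alpha] !=set0 ->
  (forall S : subalgClosed A, fin_dim_generated U S ->
     exists nu_S : {measure set
         (borel (character_space (restrict_nonempty S XA0))) -> \bar R},
       is_representing_radon (L \o @subalg_incl R A S) nu_S) ->
  let B := subalg (generated U) in
  let iota : B -> A := @subalg_incl R A (generated U) in
  let M := [set alpha : character B |
              seminorm_continuous (iota @^-1` U) (q \o iota) alpha] in
  exists nu : {measure set
      (borel (character_space (restrict_nonempty (generated U) XA0)))
      -> \bar R},
    is_representing_radon (L \o iota) nu /\ nu (~` M) = 0%E.
Proof.
move=> U q _ nu_ex B iota M.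
have [F [FU tailsF]] := ultraFilterLemma (@stage_tails_proper R A).
have nu_exi i := cid (nu_ex _ (approximant_fin_dim V_subspace L_pos e_inj e_cos lambda i)).
exact: (representing_on_generated L1 L_pos e_inj e_cos lambda_gt0 lambda_sum
  tailsF (fun i => svalP (nu_exi i))).
Qed.
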